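(* Let $E$, $\mu$, $\mathcal{E}$, $(G_\alpha)_{\alpha>0}$, $(T_t)_{t>0}$, the potential operator $G$, the sectorial Dirichlet form $(\mathcal{E}^0,D(\mathcal{E}^0))$, the linear operator $(N,D(N))$ and the set $D$ be as in the context. Suppose $(T_t)_{t>0}$ is transient and let $g\in L^1(E,\mu)_b$ with $g>0$ $\mu$-a.e. and $Gg\in L^\infty(E,\mu)$. Then $Gg$ is in the extended Dirichlet space of $D(\mathcal{E}^0)$ and one can define $\mathcal{E}^0(Gg,u):=\lim_{\alpha\to 0}\mathcal{E}^0(G_\alpha g,u)$ for $u\in D(\mathcal{E}^0)$ (i.e. this limit exists). Moreover, if $u\in D$, then $$(u,g)=\mathcal{E}^0(Gg,u)+\int_E Gg\cdot Nu\,d\mu.$$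
   Context: $E$ is a Hausdorff topological space whose Borel $\sigma$-algebra $\mathcal{B}(E)$ is generated by the continuous functions on $E$; $\mu$ is a $\sigma$-finite positive measure on $\mathcal{B}(E)$; $\mathcal{H}:=L^2(E,\mu)$ with inner product $(\cdot,\cdot)$. For a set $W$ of functions on $E$, $W_b$ denotes the set of $\mu$-a.e. bounded elements of $W$. An operator $S$ is sub-Markovian if $0\le f\le 1$ implies $0\le Sf\le 1$; a resolvent $(G_\alpha)_{\alpha>0}$ is sub-Markovian if all $\alpha G_\alpha$ are. Dirichlet forms. A (not necessarily symmetric) Dirichlet form on $\mathcal{H}$ is a bilinear form $\mathcal{A}$ on a dense linear subspace $\mathcal{V}\subset\mathcal{H}$ with $\mathcal{A}(u,u)\ge 0$, such that $\mathcal{V}$ is complete for the norm $\|u\|_{\mathcal{V}}=(\mathcal{A}(u,u)+(u,u))^{1/2}$, the weak sector condition $|\mathcal{A}_1(u,v)|\le K\mathcal{A}_1(u,u)^{1/2}\mathcal{A}_1(v,v)^{1/2}$ holds for some $K>0$ (with $\mathcal{A}_1=\mathcal{A}+(\cdot,\cdot)$), and for all $u\in\mathcal{V}$: $u^+\wedge 1\in\mathcal{V}$, $\mathcal{A}(u+u^+\wedge 1,u-u^+\wedge 1)\ge 0$ and $\mathcal{A}(u-u^+\wedge 1,u+u^+\wedge 1)\ge 0$. It is called sectorial if it moreover satisfies the strong sector condition $|\mathcal{A}(u,v)|\le K\mathcal{A}(u,u)^{1/2}\mathcal{A}(v,v)^{1/2}$ for some $K>0$ and all $u,v$. Framework. $(\mathcal{A},\mathcal{V})$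 is a (not necessarily symmetric) Dirichlet form on $\mathcal{H}$, $\mathcal{V}'$ is the dual of $\mathcal{V}$ (with $\mathcal{V}\subset\mathcal{H}\subset\mathcal{V}'$), and $(\Lambda,D(\Lambda,\mathcal{H}))$ is a linear operator on $\mathcal{H}$ which generates a sub-Markovian $C_0$-semigroup of contractions on $\mathcal{H}$ that can be restricted to a $C_0$-semigroup on $\mathcal{V}$. Then $\Lambda:D(\Lambda,\mathcal{H})\cap\mathcal{V}\to\mathcal{V}'$ is closable as an operator from $\mathcal{V}$ to $\mathcal{V}'$; its closure is denoted $(\Lambda,\mathcal{F})$. The associated generalized Dirichlet form satisfies $\mathcal{E}(u,v)=\mathcal{A}(u,v)-{}_{\mathcal{V}'}\langle\Lambda u,v\rangle_{\mathcal{V}}$ for $u\in\mathcal{F}$, $v\in\mathcal{V}$. $(G_\alpha)_{\alpha>0}$ is the sub-Markovian $C_0$-resolvent of contractions on $\mathcal{H}$ with $G_\alpha(\mathcal{H})\subset\mathcal{F}$ and $\mathcal{E}(G_\alpha f,g)+\alpha(G_\alpha f,g)=(f,g)$ for $f\in\mathcal{H}$, $g\in\mathcal{V}$; $(\widehat{G}_\alpha)_{\alpha>0}$ is its adjoint; $(L,D(L))$ is the generator of $(G_\alpha)_{\alpha>0}$; $(T_t)_{t>0}$ and $(\widehat{T}_t)_{t>0}$ are the $C_0$-semigroups of contractions corresponding to $(G_\alpha)_{\alpha>0}$ and $(\widehat{G}_\alpha)_{\alpha>0}$. For $u\in D(L)$ and $v\in\mathcal{H}$ one writes $\mathcal{E}(u,v)=(-Lu,v)$.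 It is assumed that $(\widehat{T}_t)_{t>0}$ is sub-Markovian. Hence $(T_t)_{t>0}$ restricted to $L^1(E,\mu)\cap L^2(E,\mu)$ extends to a positivity preserving semigroup of contractions on $L^1(E,\mu)$, also denoted $(T_t)_{t>0}$. Potential operator and transience. For $f\in L^1(E,\mu)$, $f\ge 0$, the potential operator is $Gf:=\lim_{N\to\infty}\int_0^N T_tf\,dt=\lim_{\alpha\to 0}\int_0^\infty e^{-\alpha t}T_tf\,dt\in[0,\infty]$ ($\mu$-a.e. defined). $(T_t)_{t>0}$ is transient if there is $g\in L^1(E,\mu)$, $g>0$ $\mu$-a.e., with $Gg<\infty$ $\mu$-a.e. Decomposition assumption. There are a sectorial Dirichlet form $(\mathcal{E}^0,D(\mathcal{E}^0))$ on $L^2(E,\mu)$ with $D(L)_b\subset D(\mathcal{E}^0)$ and a linear operator $(N,D(N))$ on $\mathcal{H}$ (not necessarily a generator) such that $$\mathcal{E}(u,v)=(-Lu,v)=\mathcal{E}^0(u,v)+\int_E u\,Nv\,d\mu\quad\text{for all }u\in D(L)_b,\ v\in D(N)\cap D(\mathcal{E}^0),$$ and $\mathcal{E}^0(u,u)\le\mathcal{E}(u,u)$ for all $u\in D(L)_b$. Set $D:=\{u\in D(N)\cap D(\mathcal{E}^0): Nu\in L^1(E,\mu)\}$. The extended Dirichlet space of $D(\mathcal{E}^0)$ is the set of all measurable functions $u$ with $|u|<\infty$ $\mu$-a.e. for which there is an $\mathcal{E}^0$-Cauchy sequence $(u_n)_{n\ge1}\subset D(\mathcal{E}^0)$ with $\lim_{n\to\infty}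 u_n=u$ $\mu$-a.e.; for such $u$, $\mathcal{E}^0(u,u):=\lim_{n\to\infty}\mathcal{E}^0(u_n,u_n)$ exists and is independent of the choice of $(u_n)$. *)

(* Defs.v *)
From HB Require Import structures.
From mathcomp Require Import all_boot all_order all_algebra.
From mathcomp Require Import all_classical all_reals all_analysis.
From mathcomp Require Import measurable_realfun ess_sup_inf.

Set Implicit Arguments.
Unset Strict Implicit.
Unset Printing Implicit Defensive.

Import Order.TTheory GRing.Theory Num.Theory.
Import numFieldTopology.Exports numFieldNormedType.Exports.

Local Open Scope classical_set_scope.
Local Open Scope ring_scope.

(* Elements of L^p(mu) are represented by measurable functions T -> R;        *)
(* domains are saturated for mu-a.e. equality, and identities between         *)
(* functions are stated mu-a.e.                                               *)

Definition borel (E : ptopologicalType) := g_sigma_algebraType (@open E).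

Definition borel_generated_by_continuous (R : realType) (E : ptopologicalType) :=
  <<s [set A : set E | exists f : E -> R, continuous f /\
        exists2 B : set R, measurable B & A = f @^-1` B] >> = <<s @open E >>.

Section Lp.
Context (d : measure_display) (T : measurableType d) (R : realType).
Variable mu : {measure set T -> \bar R}.
Implicit Types (f g u v : T -> R) (X Y D : set (T -> R)).

Definition L1 : set (T -> R) := [set f | f \in Lfun mu 1].
Definition L2 : set (T -> R) := [set f | f \in Lfun mu 2%:E].
Definition Loo : set (T -> R) := [set f | f \in Lfun mu +oo%E].

Definition norm1 f : R := fine ('N[mu]_1[EFin \o f])%E.
Definition norm2 f : R := fine ('N[mu]_2%:E[EFin \o f])%E.
Definition inner f g : R := \int[mu]_x (f x * g x).

Definition bounded_part X : set (T -> R) := X `&` Loo.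

Record is_subspace X : Prop := IsSubspace {
  subspace0 : X 0 ;
  subspaceP : forall (a : R) f g, X f -> X g -> X (a *: f + g) ;
  subspace_ae : forall f g, X f -> measurable_fun setT g ->
    f = g %[ae mu] -> X g }.

Record is_linear_op X Y (S : (T -> R) -> T -> R) : Prop := IsLinearOp {
  linear_op_maps : forall f, X f -> Y (S f) ;
  linear_op_ae : forall f g, X f -> X g -> f = g %[ae mu] ->
    S f = S g %[ae mu] ;
  linear_opP : forall (a : R) f g, X f -> X g ->
    S (a *: f + g) = a *: S f + S g %[ae mu] }.

(* A linear operator on L^2 with domain D, not necessarily bounded.           *)
Definition is_operator D (S : (T -> R) -> T -> R) : Prop :=
  [/\ D `<=` L2, is_subspace D & is_linear_op D L2 S].

Definition sub_markovian (S : (T -> R) -> T -> R) : Prop :=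
  forall f, L2 f -> (\forall x \ae mu, 0 <= f x <= 1) ->
    \forall x \ae mu, 0 <= S f x <= 1.

Definition positivity_preserving X (S : (T -> R) -> T -> R) : Prop :=
  forall f, X f -> (\forall x \ae mu, 0 <= f x) ->
    \forall x \ae mu, 0 <= S f x.

Definition cauchy_for (p : (T -> R) -> R) (u : nat -> T -> R) : Prop :=
  forall e : R, 0 < e -> exists n0 : nat, forall m n : nat,
    (n0 <= m)%N -> (n0 <= n)%N -> p (u m - u n) < e.

(* Families indexed by R are only used at positive arguments.                 *)
Definition is_contraction_family (nrm : (T -> R) -> R) X
    (S : R -> (T -> R) -> T -> R) : Prop :=
  forall t : R, 0 < t -> forall f, X f -> nrm (S t f) <= nrm f.

Definition semigroup_law X (S : R -> (T -> R) -> T -> R) : Prop :=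
  forall s t : R, 0 < s -> 0 < t -> forall f, X f ->
    S (s + t) f = S s (S t f) %[ae mu].

Record is_C0_semigroup (nrm : (T -> R) -> R) X
    (S : R -> (T -> R) -> T -> R) : Prop := IsC0Semigroup {
  C0_semigroup_linear : forall t : R, 0 < t -> is_linear_op X X (S t) ;
  C0_semigroup_bounded : forall t : R, 0 < t ->
    exists M : R, forall f, X f -> nrm (S t f) <= M * nrm f ;
  C0_semigroup_law : semigroup_law X S ;
  C0_semigroup_cvg : forall f, X f -> nrm (S t f - f) @[t --> 0^'+] --> 0 }.

Definition generator_limit (S : R -> (T -> R) -> T -> R) f g : Prop :=
  L2 g /\ norm2 (t^-1 *: (S t f - f) - g) @[t --> 0^'+] --> 0.

Definition is_generator (S : R -> (T -> R) -> T -> R) D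
    (L : (T -> R) -> T -> R) : Prop :=
  D = [set f | L2 f /\ exists g, generator_limit S f g] /\
  (forall f, D f -> generator_limit S f (L f)).

Record is_C0_contraction_resolvent (G : R -> (T -> R) -> T -> R) : Prop :=
  IsC0ContractionResolvent {
  resolvent_linear : forall a : R, 0 < a -> is_linear_op L2 L2 (G a) ;
  resolvent_contraction :
    is_contraction_family norm2 L2 (fun a f => a *: G a f) ;
  resolvent_identity : forall a b : R, 0 < a -> 0 < b -> forall f, L2 f ->
    G a f - G b f = (b - a) *: G a (G b f) %[ae mu] ;
  resolvent_cvg : forall f, L2 f ->
    norm2 (a *: G a f - f) @[a --> +oo%R] --> 0 }.

(* D = G_a(L^2) and L = a - G_a^{-1}, for every a > 0.                        *)
Definition is_resolvent_generator (G : R -> (T -> R) -> T -> R) D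
    (L : (T -> R) -> T -> R) : Prop :=
  forall a : R, 0 < a ->
  D = [set u | L2 u /\ exists2 f, L2 f & u = G a f %[ae mu]] /\
  (forall u, D u -> L2 (L u) /\ G a (a *: u - L u) = u %[ae mu]).

Definition semigroup_of_resolvent (G S : R -> (T -> R) -> T -> R) : Prop :=
  [/\ is_C0_semigroup norm2 L2 S, is_contraction_family norm2 L2 S &
      exists D L, is_resolvent_generator G D L /\ is_generator S D L].

Definition is_adjoint (S S' : (T -> R) -> T -> R) : Prop :=
  is_linear_op L2 L2 S' /\
  (forall f g, L2 f -> L2 g -> inner (S f) g = inner f (S' g)).

(* S1 is the extension to L^1 of the restriction of S to L^1 n L^2.           *)
Record is_L1_extension (S S1 : R -> (T -> R) -> T -> R) : Prop :=
  IsL1Extension {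
  L1_extension_linear : forall t : R, 0 < t -> is_linear_op L1 L1 (S1 t) ;
  L1_extension_eq : forall t : R, 0 < t -> forall f, L1 f -> L2 f ->
    S1 t f = S t f %[ae mu] ;
  L1_extension_contraction : is_contraction_family norm1 L1 S1 ;
  L1_extension_positive : forall t : R, 0 < t ->
    positivity_preserving L1 (S1 t) ;
  L1_extension_law : semigroup_law L1 S1 }.

End Lp.

Section Forms.
Context (d : measure_display) (T : measurableType d) (R : realType).
Variable mu : {measure set T -> \bar R}.
Variables (V : set (T -> R)) (A : (T -> R) -> (T -> R) -> R).
Implicit Types (u v w : T -> R).

Definition form1 u v : R := A u v + inner mu u v.
Definition form_norm u : R := Num.sqrt (form1 u u).

Definition unit_contraction u : T -> R :=
  fun x => Num.min (Num.max (u x) 0) 1.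

Record is_dirichlet_form : Prop := IsDirichletForm {
  form_sub : V `<=` L2 mu ;
  form_subspace : is_subspace mu V ;
  form_dense : forall f, L2 mu f -> forall e : R, 0 < e ->
    exists2 v, V v & norm2 mu (f - v) < e ;
  form_ae : forall u u' v v', V u -> V u' -> V v -> V v' ->
    u = u' %[ae mu] -> v = v' %[ae mu] -> A u v = A u' v' ;
  form_linear_l : forall (a : R) u u' v, V u -> V u' -> V v ->
    A (a *: u + u') v = a * A u v + A u' v ;
  form_linear_r : forall (a : R) u v v', V u -> V v -> V v' ->
    A u (a *: v + v') = a * A u v + A u v' ;
  form_ge0 : forall u, V u -> 0 <= A u u ;
  form_complete : forall u : nat -> T -> R, (forall n, V (u n)) ->
    cauchy_for form_norm u ->
    exists2 w, V w & form_norm (u n - w) @[n --> \oo] --> 0 ;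
  form_weak_sector : exists2 K : R, 0 < K & forall u v, V u -> V v ->
    `|form1 u v| <= K * Num.sqrt (form1 u u) * Num.sqrt (form1 v v) ;
  form_contraction : forall u, V u -> V (unit_contraction u) ;
  form_contraction_l : forall u, V u ->
    0 <= A (u + unit_contraction u) (u - unit_contraction u) ;
  form_contraction_r : forall u, V u ->
    0 <= A (u - unit_contraction u) (u + unit_contraction u) }.

Definition is_sectorial_dirichlet_form : Prop :=
  is_dirichlet_form /\
  exists2 K : R, 0 < K & forall u v, V u -> V v ->
    `|A u v| <= K * Num.sqrt (A u u) * Num.sqrt (A v v).

Definition extended_dirichlet_space : set (T -> \bar R) :=
  [set w : T -> \bar R | [/\ measurable_fun [set: T] w,
      (\forall x \ae mu, (`|w x| < +oo)%E) &
      exists u : nat -> T -> R, [/\ (forall n, V (u n)),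
        cauchy_for (fun v => A v v) u &
        \forall x \ae mu, (u n x)%:E @[n --> \oo] --> w x]]].

(* The dual V' of (V, form_norm); only the values on V are meaningful.        *)
Definition dual : set ((T -> R) -> R) :=
  [set l : (T -> R) -> R |
    (forall (a : R) u v, V u -> V v -> l (a *: u + v) = a * l u + l v) /\
    exists M : R, forall v, V v -> `|l v| <= M * form_norm v].

Definition dual_norm (l : (T -> R) -> R) : \bar R :=
  ereal_sup [set `|l v|%:E | v in [set v | V v /\ form_norm v <= 1]].

(* Lam with domain DLam n V is viewed as an operator from V to V' through the *)
(* embedding h |-> (h, .) of L^2 into V'.                                     *)
Section Generalized.
Variables (DLam : set (T -> R)) (Lam : (T -> R) -> T -> R).

Definition closure_graph u (l : (T -> R) -> R) : Prop :=
  [/\ V u, dual l &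
    exists w : nat -> T -> R, [/\ (forall n, (DLam `&` V) (w n)),
      form_norm (w n - u) @[n --> \oo] --> 0 &
      dual_norm (fun v => inner mu (Lam (w n)) v - l v) @[n --> \oo] --> 0%E]].

Definition closure_dom : set (T -> R) := [set u | exists l, closure_graph u l].

(* On V, the value does not depend on the choice: the operator is closable.   *)
Definition closure_op u : (T -> R) -> R := xget (fun=> 0) (closure_graph u).

Definition generalized_form u v : R := A u v - closure_op u v.

End Generalized.

(* Lam generates a sub-Markovian C_0-semigroup of contractions on L^2 which   *)
(* restricts to a C_0-semigroup on V.                                         *)
Definition generates_restrictable_semigroup (DLam : set (T -> R))
    (Lam : (T -> R) -> T -> R) : Prop :=
  exists U : R -> (T -> R) -> T -> R,
    [/\ is_C0_semigroup mu (norm2 mu) (L2 mu) U,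
        is_contraction_family (norm2 mu) (L2 mu) U,
        (forall t : R, 0 < t -> sub_markovian mu (U t)),
        is_generator mu U DLam Lam &
        is_C0_semigroup mu form_norm V U].

End Forms.

Section Potential.
Context (d : measure_display) (T : measurableType d) (R : realType).
Variable mu : {measure set T -> \bar R}.
Variable S : R -> (T -> R) -> T -> R.

(* h is the L^1-valued integral of t |-> S_t f over ]0, N], characterized by  *)
(* testing against the dual of L^1.                                           *)
Definition is_time_integral (f : T -> R) (N : R) (h : T -> R) : Prop :=
  L1 mu h /\
  forall phi : T -> R, Loo mu phi ->
    lebesgue_measure.-integrable `]0, N]
      (fun t => (\int[mu]_x (S t f x * phi x))%:E) /\
    \int[mu]_x (h x * phi x) =
    \int[lebesgue_measure]_(t in `]0, N]) \int[mu]_x (S t f x * phi x).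

(* h is a version of the potential of f.                                      *)
Definition is_potential (f : T -> R) (h : T -> \bar R) : Prop :=
  measurable_fun [set: T] h /\
  exists I : nat -> T -> R, (forall n, is_time_integral f n%:R (I n)) /\
    \forall x \ae mu, (I n x)%:E @[n --> \oo] --> h x.

Definition transient : Prop :=
  exists (f : T -> R) (h : T -> \bar R),
    [/\ L1 mu f, (\forall x \ae mu, 0 < f x), is_potential f h &
        \forall x \ae mu, (h x < +oo)%E].

End Potential.

(* Main.v *)
(** Differentiating e^{-at}(T_t G_a g, 1_B) gives, after integration in time,
    e^{-aN} I_N <= G_a g <= Gg a.e., where I_N is the integral of T_t g over
    ]0, N]. Hence 0 <= G_a g <= Gg and G_a g -> Gg boundedly a.e. as a -> 0, and
    E0(G_a g, G_a g) + a |G_a g|^2 <= (g, G_a g) is bounded by |g|_1 |Gg|_oo.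

    The functions of D(E0) lying in [(1 - 1/n) I_n, Gg] form a decreasing
    sequence of convex sets on which E0 has bounded infima; near-minimisers are
    E0-Cauchy and converge a.e. to Gg.

    For the weak convergence of G_a g, let r be the 1-potential of 1_B, mu B
    finite, for the symmetric part E of E0. As 0 <= r <= 1 and r is integrable,
    E(G_a g, r) = (G_a g, 1_B) - (G_a g, r) converges by dominated convergence.
    These r span a dense subspace, and the energies are bounded, so E(G_a g, v)
    converges for all v; so does E0(G_a g, v), since by the strong sector
    condition E0(., v) is an E0-uniform limit of functionals E(., w).

    The identity is the limit of (g - a G_a g, u) = E0(G_a g, u) + (G_a g, N u). *)
Require Import Defs.
From HB Require Import structures.
From mathcomp Require Import all_boot all_order all_algebra.
From mathcomp Require Import all_classical all_reals all_analysis.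
From mathcomp Require Import measurable_realfun ess_sup_inf.
From mathcomp Require Import ring lra.
Set Implicit Arguments.
Unset Strict Implicit.
Unset Printing Implicit Defensive.
Import Order.TTheory GRing.Theory Num.Theory.
Import numFieldTopology.Exports numFieldNormedType.Exports.
Local Open Scope classical_set_scope.
Local Open Scope ring_scope.

(** * Semi-inner products on a subset of a vector space: Cauchy-Schwarz and Riesz representation *)

Section SemiInner.
Context (R : realType) (X : lmodType R).
Implicit Types (D S : set X) (B : X -> X -> R) (u v w x y : X).

Definition lin_closed D :=
  D 0 /\ forall (a : R) u v, D u -> D v -> D (a *: u + v).

Definition linear_on D (l : X -> R) :=
  forall (a : R) u v, D u -> D v -> l (a *: u + v) = a * l u + l v.

(** Functions equal a.e. are not identified, so the form may vanish on non-zero vectors, and the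
    axioms hold on the subset [D] only. Linearity in the second argument follows from symmetry. *)
Record semi_inner D B : Prop := SemiInner {
  semi_inner_dom : lin_closed D ;
  semi_inner_linear : forall v, D v -> linear_on D (B^~ v) ;
  semi_inner_sym : forall u v, D u -> D v -> B u v = B v u ;
  semi_inner_ge0 : forall u, D u -> 0 <= B u u }.

Section lin_closed.
Variable D : set X.
Hypothesis linD : lin_closed D.

Lemma lin_closedZ a u : D u -> D (a *: u).
Proof. by case: linD => D0 DP Du; rewrite -[_ *: _]addr0; apply: DP. Qed.

Lemma lin_closedD u v : D u -> D v -> D (u + v).
Proof. by case: linD => D0 DP Du Dv; rewrite -[u]scale1r; apply: DP. Qed.

Lemma lin_closedB u v : D u -> D v -> D (u - v).
Proof.
by move=> Du Dv; rewrite -scaleN1r; apply: lin_closedD => //; apply: lin_closedZ.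
Qed.

Variables (l : X -> R) (linl : linear_on D l).

Lemma linear_on0 : l 0 = 0.
Proof.
have := linl 1 linD.1 linD.1; rewrite scale1r addr0 mul1r => h; lra.
Qed.

Lemma linear_onZ a u : D u -> l (a *: u) = a * l u.
Proof.
by move=> Du; rewrite -[_ *: _]addr0 linl ?linear_on0 ?addr0//; case: linD.
Qed.

Lemma linear_onD u v : D u -> D v -> l (u + v) = l u + l v.
Proof. by move=> Du Dv; rewrite -[u]scale1r linl// scale1r mul1r. Qed.

Lemma linear_onB u v : D u -> D v -> l (u - v) = l u - l v.
Proof.
move=> Du Dv; rewrite -scaleN1r linear_onD ?linear_onZ//.
  by rewrite mulN1r.
exact: lin_closedZ.
Qed.

End lin_closed.

Section semi_inner_theory.
Variables (D : set X) (B : X -> X -> R).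
Hypothesis siB : semi_inner D B.

Let linD : lin_closed D := semi_inner_dom siB.
Let linl v (Dv : D v) : linear_on D (B^~ v) := semi_inner_linear siB Dv.

Lemma semi_innerZDr a u v w : D u -> D v -> D w ->
  B w (a *: u + v) = a * B w u + B w v.
Proof.
move=> Du Dv Dw.
rewrite !(semi_inner_sym siB Dw)//; first exact: linl.
by apply: linD.2.
Qed.

Lemma semi_inner_expand t u v : D u -> D v ->
  B (t *: u + v) (t *: u + v) = t ^+ 2 * B u u + 2 * t * B u v + B v v.
Proof.
move=> Du Dv; have Dt : D (t *: u + v) by apply: linD.2.
rewrite linl// !semi_innerZDr// (semi_inner_sym siB Dv Du); ring.
Qed.

Lemma semi_innerB u v : D u -> D v ->
  B (u - v) (u - v) = B u u - 2 * B u v + B v v.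
Proof.
move=> Du Dv; rewrite addrC -scaleN1r semi_inner_expand//.
rewrite (semi_inner_sym siB Dv Du); ring.
Qed.

(** The discriminant of a nonnegative quadratic in [t]. The constant term is a square [e ^+ 2], to
    serve both as a squared norm, for Cauchy-Schwarz, and as the slack of a near-minimiser. *)
Lemma semi_inner_disc e (q c : R) : 0 <= q ->
  (forall t : R, 0 <= t ^+ 2 * q + 2 * t * c + e ^+ 2) ->
  `|c| <= `|e| * Num.sqrt q.
Proof.
move=> q0 H; have e0 : 0 <= e ^+ 2 by rewrite sqr_ge0.
rewrite -!sqrtr_sqr -sqrtrM// ler_wsqrtr//.
have [qp|] := ltP 0 q.
  (* The minimum point of the quadratic. *)
  have := H (- c / q).
  rewrite (_ : _ + _ = e ^+ 2 - c ^+ 2 / q); last by field; rewrite gt_eqF.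
  by rewrite subr_ge0 ler_pdivrMr.
move=> q0'; have q00 : q = 0 by apply/eqP; rewrite eq_le q0 q0'.
have [->|c0] := eqVneq c 0; first by rewrite expr0n mulr_ge0.
(* For [q = 0] the quadratic is affine, and this argument brings it to -1. *)
have := H (- (e ^+ 2 + 1) / (2 * c)).
rewrite q00 mulr0 (_ : _ + _ = -1); last by field.
by rewrite lerNr oppr0 ler10.
Qed.

Lemma semi_inner_CS u v : D u -> D v ->
  `|B u v| <= Num.sqrt (B u u) * Num.sqrt (B v v).
Proof.
move=> Du Dv.
have := @semi_inner_disc (Num.sqrt (B v v)) (B u u) (B u v).
rewrite [`|Num.sqrt _|]ger0_norm ?sqrtr_ge0// mulrC; apply.
  exact: (semi_inner_ge0 siB Du).
move=> t; rewrite sqr_sqrtr ?(semi_inner_ge0 siB)// -semi_inner_expand//.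
by apply: (semi_inner_ge0 siB); apply: linD.2.
Qed.

(* A near-minimiser r of w |-> B w w - 2 l w works, so no completeness is
   needed. *)
Lemma approx_riesz (S : set X) (l : X -> R) (c e : R) : S `<=` D ->
  lin_closed S -> linear_on S l ->
  (forall w, S w -> `|l w| <= c * Num.sqrt (B w w)) -> 0 < e ->
  exists2 r, S r & forall w, S w -> `|l w - B r w| <= e * Num.sqrt (B w w).
Proof.
move=> SD linS linL bl e0.
pose J x := B x x - 2 * l x.
have hasJ : has_inf [set J x | x in S].
  split; first by exists (J 0), 0 => //; case: linS.
  (* With [s] the norm of [x], [J x >= s^2 - 2cs = (s - c)^2 - c^2]. *)
  exists (- c ^+ 2) => _ [x Sx <-]; rewrite /J.
  have := bl x Sx; have := sqr_sqrtr (semi_inner_ge0 siB (SD _ Sx)).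
  move: (Num.sqrt _) => s <- /ler_normlW ls; have := sqr_ge0 (s - c).
  by rewrite sqrrB; lra.
have [_ [r Sr <-] Jr] := inf_adherent (exprn_gt0 2 e0) hasJ.
exists r => // w Sw.
have := @semi_inner_disc e (B w w) (B r w - l w).
rewrite (ger0_norm (ltW e0)) distrC; apply.
  exact: (semi_inner_ge0 siB (SD _ Sw)).
(* As [r] is within [e^2] of the infimum, [J (t w + r) >= J r - e^2]; expanded, this is the
   quadratic inequality in [t]. *)
move=> t.
have Srw : S (t *: w + r) by apply: linS.2.
have : inf [set J x | x in S] <= J (t *: w + r).
  by apply: ge_inf; [case: hasJ|exists (t *: w + r)].
rewrite /J semi_inner_expand ?linL//; try exact: SD.
rewrite (semi_inner_sym siB (SD _ Sw) (SD _ Sr)).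
move: Jr; rewrite /J; lra.
Qed.

Definition semi_norm u := Num.sqrt (B u u).

(** Take approximate representatives [r n] of precision [1/(n+1)]. Testing a difference on itself
    bounds its norm by the sum of the two precisions, so the sequence is Cauchy and its limit
    represents [l] exactly. *)
Lemma riesz (S : set X) (l : X -> R) (c : R) : S `<=` D ->
  lin_closed S -> linear_on S l ->
  (forall w, S w -> `|l w| <= c * Num.sqrt (B w w)) ->
  (forall u : nat -> X, (forall n, S (u n)) ->
    (forall e : R, 0 < e -> exists n0 : nat, forall m n : nat,
      (n0 <= m)%N -> (n0 <= n)%N -> semi_norm (u m - u n) < e) ->
    exists2 w, S w & semi_norm (u n - w) @[n --> \oo] --> 0) ->
  exists2 r, S r & forall w, S w -> l w = B r w.
Proof.
move=> SD linS linL bl complS.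
have inv0 n : 0 < n.+1%:R^-1 :> R by rewrite invr_gt0.
have /choice[r rP] : forall n : nat, exists r, S r /\
    forall w, S w -> `|l w - B r w| <= n.+1%:R^-1 * Num.sqrt (B w w).
  by move=> n; have [r Sr rP] := approx_riesz SD linS linL bl (inv0 n); exists r.
have Sr n : S (r n) by case: (rP n).
have rmn m n w : S w ->
    `|B (r m - r n) w| <= (m.+1%:R^-1 + n.+1%:R^-1) * Num.sqrt (B w w).
  move=> Sw; rewrite (linear_onB linD (linl (SD _ Sw))); try exact: SD.
  have /ler_normlP[h1 h2] := (rP m).2 w Sw.
  have /ler_normlP[h3 h4] := (rP n).2 w Sw.
  move: h1 h2 h3 h4; rewrite mulrDl.
  move: (m.+1%:R^-1 * _) (n.+1%:R^-1 * _) => p q *.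
  by apply/ler_normlP; split; lra.
have cauchy m n : semi_norm (r m - r n) <= m.+1%:R^-1 + n.+1%:R^-1.
  have Smn : S (r m - r n) by apply: lin_closedB.
  have := rmn m n _ Smn; rewrite -/(semi_norm _).
  rewrite ger0_norm; last exact: (semi_inner_ge0 siB (SD _ Smn)).
  (* The bound on the squared norm is divided by the norm, so a vanishing norm is set apart. *)
  have [->|n0] := eqVneq (semi_norm (r m - r n)) 0.
    by rewrite addr_ge0.
  rewrite -[X in X <= _](sqr_sqrtr (semi_inner_ge0 siB (SD _ Smn))).
  rewrite -/(semi_norm _) expr2 ler_pM2r// lt_neqAle eq_sym n0 /=.
  exact: sqrtr_ge0.
have [||x Sx rx] := complS r; first by [].
  move=> e e0; have e20 : 0 < e / 2 by rewrite divr_gt0.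
  have /cvgrPdist_lt/(_ _ e20)[n0 _ n0P] := @cvg_harmonic R.
  exists n0 => m n /n0P /= hm /n0P /= hn; apply: le_lt_trans (cauchy m n) _.
  move: hm hn; rewrite !sub0r !normrN !ger0_norm//; try exact: ltW.
  by move=> hm hn; rewrite [e]splitr; exact: ltrD.
exists x => // w Sw.
apply/eqP; rewrite -subr_eq0 -normr_le0; apply/ler_addgt0Pl => e e0.
rewrite addr0.
have : (n.+1%:R^-1 + semi_norm (r n - x)) * Num.sqrt (B w w) @[n --> \oo] -->
   (0 + 0) * Num.sqrt (B w w).
  apply: cvgMl; apply: cvgD => //; exact: cvg_harmonic.
rewrite addr0 mul0r => /cvgrPdist_lt/(_ _ e0)[n _ /(_ n (leqnn n))] /=.
rewrite sub0r normrN => h; apply: le_trans (ltW (le_lt_trans (ler_norm _) h)).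
have /= := semi_inner_CS (SD _ (lin_closedB linS (Sr n) Sx)) (SD _ Sw).
rewrite (linear_onB linD (linl (SD _ Sw))); try exact: SD.
move=> /ler_normlP[h1 h2]; have /ler_normlP[h3 h4] := (rP n).2 w Sw.
move: h1 h2 h3 h4; rewrite mulrDl -/(semi_norm _).
move: (n.+1%:R^-1 * _) (semi_norm (r n - x) * _) => p q *.
by apply/ler_normlP; split; lra.
Qed.

End semi_inner_theory.
End SemiInner.

(** * Integrable, square-integrable and essentially bounded functions *)

Section L2.
Context (d : measure_display) (T : measurableType d) (R : realType).
Variable mu : {measure set T -> \bar R}.
Implicit Types (f g h : T -> R) (B : set T).

Lemma integrable_Rmeasurable f :
  mu.-integrable setT (EFin \o f) -> measurable_fun setT f.
Proof. by move=> /(measurable_int mu)/measurable_EFinP. Qed.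

Lemma ae_eq_Rintegral f g : measurable_fun setT f -> measurable_fun setT g ->
  f = g %[ae mu] -> \int[mu]_x f x = \int[mu]_x g x.
Proof.
move=> mf mg fg; rewrite /Rintegral; congr fine; apply: ae_eq_integral => //.
- exact/measurable_EFinP.
- exact/measurable_EFinP.
- by apply: filterS fg => x /= /(_ I) ->.
Qed.

Lemma ae_le_Rintegral f g :
  mu.-integrable setT (EFin \o f) -> mu.-integrable setT (EFin \o g) ->
  (\forall x \ae mu, f x <= g x) -> \int[mu]_x f x <= \int[mu]_x g x.
Proof.
move=> intf intg fg; rewrite -subr_ge0 -RintegralB//.
have mf := integrable_Rmeasurable intf; have mg := integrable_Rmeasurable intg.
rewrite (@ae_eq_Rintegral _ (fun x => `|g x - f x|)).
- by apply: Rintegral_ge0 => x _.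
- exact: measurable_funB.
- by apply: measurableT_comp => //; exact: measurable_funB.
- by apply: filterS fg => x fg _; rewrite ger0_norm// subr_ge0.
Qed.

Lemma ae_le_integrable f g : measurable_fun setT f ->
  mu.-integrable setT (EFin \o g) -> (\forall x \ae mu, `|f x| <= g x) ->
  mu.-integrable setT (EFin \o f).
Proof.
move=> mf intg fg; have mg := integrable_Rmeasurable intg.
apply/integrableP; split; first exact/measurable_EFinP.
have /integrableP[_] := intg; apply: le_lt_trans.
apply: ae_ge0_le_integral => //.
- by apply: measurableT_comp => //; exact/measurable_EFinP.
- by apply: measurableT_comp => //; exact/measurable_EFinP.
- apply: filterS fg => x fg _ /=; rewrite lee_fin.
  exact: le_trans fg (ler_norm _).
Qed.

Lemma L1P f : L1 mu f <-> mu.-integrable setT (EFin \o f).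
Proof. exact: Lfun1_integrable. Qed.

Lemma Lp_measurable p f : f \in Lfun mu p -> measurable_fun setT f.
Proof. by rewrite inE => /andP[/[!inE]]. Qed.

Lemma LooP f : Loo mu f <->
  measurable_fun setT f /\ exists M : R, \forall x \ae mu, `|f x| <= M.
Proof.
split=> [fL|].
  split; first exact: Lp_measurable fL.
  have := sub_Lfun_finLfun fL; rewrite inE /= /finite_norm unlock => h.
  case: ifPn h => [mu0 h|mu0 _].
    by apply: (@ess_supr_bounded _ _ _ mu (fun x => `|f x|)).
  (* The norm is defined by cases on the total mass; here the whole space is null, so any bound
     holds a.e. *)
  exists 0; exists setT; split => //; apply/eqP; rewrite eq_le measure_ge0 andbT.
  by rewrite leNgt.
move=> [mf [M fM]]; rewrite /Loo /= inE; apply/andP; split; rewrite inE //=.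
rewrite /finite_norm unlock; case: ifPn => // _.
have : (ess_sup mu (abse \o (EFin \o f)) <= M%:E)%E.
  by apply/ess_supP; apply: filterS fM => x; rewrite lee_fin.
by move/le_lt_trans; apply; rewrite ltry.
Qed.

Lemma L2P f : L2 mu f <->
  measurable_fun setT f /\ mu.-integrable setT (EFin \o (fun x => f x ^+ 2)).
Proof.
split=> [f2|[mf intf]].
  by split; [exact: Lp_measurable f2|exact: Lfun2_integrable_sqr].
rewrite /L2 /= inE; apply/andP; split; rewrite inE //=.
rewrite /finite_norm unlock poweR_lty//.
have /integrableP[_] := intf; apply: le_lt_trans.
rewrite le_eqVlt; apply/orP; left; apply/eqP; apply: eq_integral => x _ /=.
by rewrite powR_mulrn// normrX.
Qed.

Lemma L2_mul_integrable f g : L2 mu f -> L2 mu g ->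
  mu.-integrable setT (EFin \o (fun x => f x * g x)).
Proof. by move=> f2 g2; apply/Lfun1_integrable; exact: Lfun2_mul_Lfun1. Qed.

Lemma L2_lin : lin_closed (L2 mu).
Proof.
have [h0 hP] := @Lfun_submod_closed _ _ _ mu _ (lee1n 2).
by split=> // a f g; apply: hP.
Qed.

Lemma inner_semi : semi_inner (L2 mu) (inner mu).
Proof.
split; first exact: L2_lin.
- move=> h h2 a f g f2 g2.
  have ifh := L2_mul_integrable f2 h2; have igh := L2_mul_integrable g2 h2.
  have iafh : mu.-integrable setT (EFin \o (fun x => a * (f x * h x))).
    exact: (integrableZl measurableT a ifh).
  rewrite /inner -RintegralZl// -RintegralD//.
  by apply: eq_Rintegral => x _ /=; rewrite !fctE mulrDl -mulrA.
- by move=> f g _ _; apply: eq_Rintegral => x _; rewrite mulrC.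
- by move=> f _; apply: Rintegral_ge0 => x _; rewrite -expr2 sqr_ge0.
Qed.

Lemma innerC f g : inner mu f g = inner mu g f.
Proof. by apply: eq_Rintegral => x _; rewrite mulrC. Qed.

Lemma inner_ae f f' g g' : L2 mu f -> L2 mu f' -> L2 mu g -> L2 mu g' ->
  f = f' %[ae mu] -> g = g' %[ae mu] -> inner mu f g = inner mu f' g'.
Proof.
move=> f2 f2' g2 g2' ff' gg'; apply: ae_eq_Rintegral.
- exact/integrable_Rmeasurable/L2_mul_integrable.
- exact/integrable_Rmeasurable/L2_mul_integrable.
- by move: ff' gg'; apply: filterS2 => x /(_ I) -> /(_ I) ->.
Qed.

Lemma norm2E f : L2 mu f -> norm2 mu f = Num.sqrt (inner mu f f).
Proof.
move=> f2; rewrite /norm2 /inner /Rintegral unlock /=.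
rewrite (eq_integral (fun x => (f x * f x)%:E)); last first.
  by move=> x _; rewrite /= powR_mulrn// -normrX -expr2 ger0_norm ?sqr_ge0.
rewrite fine_poweR powR12_sqrt// fine_ge0// integral_ge0// => x _.
by rewrite lee_fin -expr2 sqr_ge0.
Qed.

Lemma inner_eq0 f : L2 mu f -> inner mu f f = 0 -> f = 0 %[ae mu].
Proof.
move=> f2 f0.
have /ae_eq_integral_abs : (\int[mu]_x `|(f x * f x)%:E| = 0)%E.
  rewrite (eq_integral (fun x => (f x * f x)%:E)); last first.
    by move=> x _; rewrite gee0_abs// lee_fin -expr2 sqr_ge0.
  rewrite -[LHS]fineK; first by congr EFin; exact: f0.
  exact: integrable_fin_num (L2_mul_integrable f2 f2).
move=> h; have := h measurableT (measurable_int mu (L2_mul_integrable f2 f2)).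
apply: filterS => x /= /(_ I) [/eqP]; rewrite mulf_eq0 orbb => /eqP -> _.
by [].
Qed.

Lemma ae_bounded_L2 f M : L1 mu f -> (\forall x \ae mu, `|f x| <= M) -> L2 mu f.
Proof.
move=> /L1P f1 fM; apply/L2P; have mf := integrable_Rmeasurable f1.
split => //; apply: (@ae_le_integrable _ (fun x => M * `|f x|)).
- exact: measurable_funX.
- rewrite (_ : _ \o _ = (fun x => M%:E * `|(f x)%:E|)%E); last by apply/funext.
  by apply: integrableZl => //; apply: integrable_abse.
- by apply: filterS fM => x fM; rewrite normrX expr2 ler_wpM2r.
Qed.

Lemma indic_L1 B : measurable B -> (mu B < +oo)%E -> L1 mu \1_B.
Proof.
move=> mB Bf.
apply/L1P/integrableP; split; first exact/measurable_EFinP/measurable_indic.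
rewrite (eq_integral (fun x => (\1_B x)%:E)); first by rewrite integral_indic// setIT.
by move=> x _ /=; rewrite ger0_norm.
Qed.

Lemma indic_Loo B : measurable B -> Loo mu \1_B.
Proof.
move=> mB; apply/LooP; split; first exact: measurable_indic.
by exists 1; apply: nearW => x; rewrite indicE; case: (_ \in _); rewrite ?normr1 ?normr0.
Qed.

Lemma indic_L2 B : measurable B -> (mu B < +oo)%E -> L2 mu \1_B.
Proof.
move=> mB Bf; have /LooP[_ [M hM]] := indic_Loo mB.
exact: ae_bounded_L2 (indic_L1 mB Bf) hM.
Qed.

Lemma Rintegral_mul_indic f B : measurable B ->
  \int[mu]_x (f x * \1_B x) = \int[mu]_(x in B) f x.
Proof.
move=> mB; rewrite [RHS]Rintegral_mkcond; apply: eq_Rintegral => x _.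
by rewrite patchE indicE; case: ifPn => _; rewrite ?mulr1 ?mulr0.
Qed.

(** On the part of a finite-measure piece where [f < 0], the integral of [f] is both nonnegative and
    nonpositive, so [|f|] integrates to 0 there. Countably many such pieces cover the space. *)
Lemma ae_all_ge0 (f : T -> R) : sigma_finite setT mu -> measurable_fun setT f ->
  (forall B, measurable B -> (mu B < +oo)%E ->
     mu.-integrable B (EFin \o f) /\ 0 <= \int[mu]_(x in B) f x) ->
  \forall x \ae mu, 0 <= f x.
Proof.
move=> [F FT Ffin] mf fP.
suff: \forall x \ae mu, forall k, F k x -> 0 <= f x.
  apply: filterS => x fx; have : [set: T] x by [].
  by rewrite FT => -[k _ Fkx]; exact: fx Fkx.
apply: ae_foralln => k; have [mFk Fkoo] := Ffin k.
pose A := F k `&` [set x | f x < 0].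
have mA : measurable A.
  apply: measurableI => //; have := mf measurableT _ (measurable_itv `]-oo, 0[).
  by rewrite setTI; congr measurable; apply/seteqP; split=> x; rewrite /= in_itv.
have Aoo : (mu A < +oo)%E.
  apply: le_lt_trans Fkoo; apply: le_measure; rewrite ?inE//.
  exact: subIsetl.
have [intA fA] := fP A mA Aoo.
have : (\int[mu]_(x in A) `|(EFin \o f) x| = 0)%E.
  apply/eqP; rewrite eq_le integral_ge0 ?andbT//.
  rewrite (eq_integral (fun x => - (f x)%:E)%E); last first.
    by move=> x /[!inE] -[_ /= fx]; rewrite ltr0_norm.
  rewrite integralN; last exact: (integrable_add_def mA intA).
  by rewrite oppe_le0 -[X in (_ <= X)%E]fineK ?lee_fin//; exact: integrable_fin_num.
move/ae_eq_integral_abs => /(_ mA (measurable_int mu intA)).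
apply: filterS => x /= fx Fkx; rewrite leNgt; apply/negP => fx0.
by have [f0] := fx (conj Fkx fx0); rewrite f0 ltxx in fx0.
Qed.

End L2.

(** * Linear operators on L^2 and the generator of a resolvent *)

Section Operators.
Context (d : measure_display) (T : measurableType d) (R : realType).
Variable mu : {measure set T -> \bar R}.
Implicit Types (f g h u v : T -> R) (S : (T -> R) -> T -> R).

Lemma ae_at f g : f = g %[ae mu] -> \forall x \ae mu, f x = g x.
Proof. by apply: filterS => x /(_ I). Qed.

Lemma linear_op0 (X Y : set (T -> R)) S :
  lin_closed X -> is_linear_op mu X Y S -> S 0 = 0 %[ae mu].
Proof.
move=> linX linS; have := linear_opP linS 1 linX.1 linX.1.
rewrite scaler0 addr0 scale1r; apply: filterS => x /(_ I) + _.
by rewrite !fctE => /eqP; rewrite -subr_eq0 opprD addNKr oppr_eq0 => /eqP.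
Qed.

Lemma linear_opB (X Y : set (T -> R)) S f g : lin_closed X ->
  is_linear_op mu X Y S -> X f -> X g -> S (f - g) = S f - S g %[ae mu].
Proof.
move=> linX linS Xf Xg; have := linear_opP linS (-1) Xg Xf.
rewrite scaleN1r addrC; apply: filterS => x /(_ I) + _ => ->.
by rewrite !fctE scaleN1r addrC.
Qed.

Lemma inner_norm2 f g : L2 mu f -> L2 mu g ->
  `|inner mu f g| <= norm2 mu f * norm2 mu g.
Proof.
by move=> f2 g2; rewrite !norm2E//; exact: (semi_inner_CS (inner_semi mu)).
Qed.

Lemma norm2_ge0 f : 0 <= norm2 mu f.
Proof. by rewrite /norm2 fine_ge0// Lnorm_ge0. Qed.

Lemma sqr_norm2 f : L2 mu f -> norm2 mu f ^+ 2 = inner mu f f.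
Proof.
by move=> f2; rewrite norm2E// sqr_sqrtr// (semi_inner_ge0 (inner_semi mu)).
Qed.

Lemma norm2_eq0 f : L2 mu f -> norm2 mu f = 0 -> f = 0 %[ae mu].
Proof.
by move=> f2 f0; apply: inner_eq0 => //; rewrite -sqr_norm2// f0 expr0n.
Qed.

Lemma norm2_ae f g : L2 mu f -> L2 mu g -> f = g %[ae mu] ->
  norm2 mu f = norm2 mu g.
Proof. by move=> f2 g2 fg; rewrite !norm2E// (inner_ae f2 g2 f2 g2 fg fg). Qed.

(* G a h = 0 forces G b h = 0 for every b, and b G_b h -> h. *)
Lemma resolvent_inj (G : R -> (T -> R) -> T -> R) a h :
  is_C0_contraction_resolvent mu G -> 0 < a -> L2 mu h ->
  G a h = 0 %[ae mu] -> h = 0 %[ae mu].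
Proof.
move=> resG a0 h2 Gh0; apply: norm2_eq0 => //.
have linG b (b0 : 0 < b) := resolvent_linear resG b0.
have G2 b (b0 : 0 < b) f (f2 : L2 mu f) := linear_op_maps (linG b b0) f2.
have L2_0 : L2 mu 0 by case: (L2_lin mu).
have Gbh b : 0 < b -> G b h = 0 %[ae mu].
  move=> b0; have := linear_op_ae (linG b b0) (G2 a a0 h h2) L2_0 Gh0.
  have G0 := linear_op0 (L2_lin mu) (linG b b0).
  have Gba := resolvent_identity resG b0 a0 h2 => GG0; near=> x => _.
  have e1 : G b (G a h) x = G b 0 x by near: x; exact: ae_at GG0.
  have e2 : G b 0 x = 0 by near: x; exact: ae_at G0.
  have e3 : G b h x - G a h x = (a - b) * G b (G a h) x.
    by near: x; exact: ae_at Gba.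
  have e4 : G a h x = 0 by near: x; exact: ae_at Gh0.
  by move: e3; rewrite e4 e1 e2 mulr0 subr0.
apply/eqP; rewrite eq_le norm2_ge0 andbT; apply/ler_addgt0Pr => e e0.
have /cvgrPdist_lt/(_ _ e0) cvGh := resolvent_cvg resG h2.
near (+oo%R : set_system R) => b.
have b0 : 0 < b by near: b; exact: nbhs_pinfty_gt.
have : `|0 - norm2 mu (b *: G b h - h)| < e by near: b; exact: cvGh.
rewrite sub0r normrN ger0_norm ?norm2_ge0// add0r => /ltW.
have bGh2 : L2 mu (b *: G b h) := lin_closedZ (L2_lin mu) b (G2 b b0 h h2).
have bGhh2 : L2 mu (b *: G b h - h) := lin_closedB (L2_lin mu) bGh2 h2.
have -> : norm2 mu (b *: G b h - h) = norm2 mu (-1 *: h).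
  apply: norm2_ae => //; first exact (lin_closedZ (L2_lin mu) _ h2).
  apply: filterS (Gbh b b0) => x /(_ I) Gx _; rewrite !fctE Gx.
  by rewrite scaler0 add0r scaleN1r.
have Nh2 : L2 mu (-1 *: h) := lin_closedZ (L2_lin mu) (-1) h2.
rewrite !norm2E// (_ : inner mu (-1 *: h) (-1 *: h) = inner mu h h)//.
by apply: eq_Rintegral => x _; rewrite !fctE scaleN1r mulrNN.
Unshelve. all: by end_near. Qed.

(** For [u = G a f] the definition only gives [G a (a u - L u) = u]; injectivity of [G a] turns this
    into [L u = a u - f]. *)
Lemma resolvent_generatorE (G : R -> (T -> R) -> T -> R) D L a f :
  is_C0_contraction_resolvent mu G -> is_resolvent_generator mu G D L ->
  0 < a -> L2 mu f ->
  [/\ D (G a f), L2 mu (L (G a f)) & L (G a f) = a *: G a f - f %[ae mu]].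
Proof.
move=> resG genL a0 f2; have linG := resolvent_linear resG a0.
have u2 : L2 mu (G a f) := linear_op_maps linG f2.
have [DE LP] := genL a a0.
have Du : D (G a f) by rewrite DE; split=> //; exists f => //; exact: ae_eq_refl.
have [Lu2 GLu] := LP _ Du; split=> //.
have au2 : L2 mu (a *: G a f) := lin_closedZ (L2_lin mu) a u2.
have w2 := lin_closedB (L2_lin mu) au2 Lu2.
have GB := linear_opB (L2_lin mu) linG w2 f2.
have /(resolvent_inj resG a0 (lin_closedB (L2_lin mu) w2 f2)) :
    G a (a *: G a f - L (G a f) - f) = 0 %[ae mu].
  move: GB GLu; apply: filterS2 => x /(_ I) + /(_ I) e2 _ => ->.
  by rewrite !fctE e2 subrr.
apply: filterS => x /(_ I) e _.
have {}e : a * G a f x - L (G a f) x - f x = 0 := e.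
rewrite !fctE -[_ *: _]/(_ * _); lra.
Qed.

End Operators.

(** * Derivatives from one-sided increments *)

Section Calculus.
Context (R : realType).
Implicit Types (p q n H F : R -> R).

Lemma continuous_expRM (a : R) : continuous (fun t : R => expR (a * t)).
Proof.
move=> t; apply: continuous_comp; last exact: continuous_expR.
by apply: cvgM; [exact: cvg_cst|exact: cvg_id].
Qed.

(** The modulus [n] is uniform in the base point, so a left increment at [s] can be read as a right
    increment based at [s + h] with [h < 0]; continuity of [q] then replaces [q (s + h)] by
    [q s]. *)
Lemma is_derive_of_modulus p q n (s : R) : 0 < s -> {for s, continuous q} ->
  n h @[h --> 0^'+] --> 0 ->
  (forall t h, 0 <= t -> 0 < h -> `|p (t + h) - p t - h * q t| <= h * n h) ->
  is_derive s 1 p (q s).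
Proof.
move=> s0 cq n0 pq.
have lim : h^-1 *: ((p \o shift s) (h *: 1) - p s) @[h --> 0^'] --> q s.
  apply/cvgrPdist_le => e e0; have e20 : 0 < e / 2 by rewrite divr_gt0.
  have /cvgrPdist_le/(_ _ e20) := n0.
  rewrite /at_right near_withinE => -[d1 /= d10 nd1].
  have /cvgrPdist_le/(_ _ e20)[d2 /= d20 qd2] := cq.
  have nd h : 0 < h -> h < d1 -> n h <= e / 2.
    move=> h0 hd; have := nd1 h; rewrite /ball /= sub0r normrN gtr0_norm//.
    by move=> /(_ hd h0); rewrite sub0r normrN => /ler_normlW.
  near=> h; have h0 : h != 0 by near: h; exact: nbhs_dnbhs_neq.
  have hs : `|h| < Num.min s (Num.min d1 d2).
    near: h; apply: dnbhs0_lt.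
    by rewrite !lt_min s0 d10 d20.
  move: hs; rewrite !lt_min => /and3P[hs h1 h2].
  rewrite /= [h *: 1]mulr1 [_ *: _]mulrC -[q s](mulfK h0) -mulrBl normrM.
  rewrite normfV ler_pdivrMr ?normr_gt0// distrC.
  have [hp|hn] := ltP 0 h.
    rewrite (addrC h) (mulrC (q s)); apply: le_trans (pq s h (ltW s0) hp) _.
    move: h1; rewrite gtr0_norm// => h1.
    by rewrite mulrC ler_wpM2r ?(ltW hp)//; have := nd _ hp h1; lra.
  have {}hn : 0 < - h by rewrite oppr_gt0 lt_neqAle h0.
  have nh : `|h| = - h by rewrite ltr0_norm// -oppr_gt0.
  rewrite !nh in hs h1 h2 *.
  have hs0 : 0 <= h + s by lra.
  have := pq _ _ hs0 hn; rewrite (_ : h + s + - h = s); last by ring.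
  move=> /ler_normlP[a1 a2].
  have : `|q s - q (h + s)| <= e / 2.
    by apply: qd2; rewrite /ball /= opprD addrCA subrr addr0 normrN nh.
  move=> /ler_normlP[b1 b2]; have := nd _ hn h1 => c1.
  by apply/ler_normlP; split; nra.
split; first by apply/cvg_ex; exists (q s).
exact: cvg_lim lim.
Unshelve. all: by end_near. Qed.

End Calculus.

(** * Scalar orbits of a contraction semigroup and their truncated Laplace transform *)

Section Semigroup.
Context (d : measure_display) (T : measurableType d) (R : realType).
Variable mu : {measure set T -> \bar R}.
Variable S : R -> (T -> R) -> T -> R.
Hypothesis C0S : is_C0_semigroup mu (norm2 mu) (L2 mu) S.
Hypothesis contrS : is_contraction_family (norm2 mu) (L2 mu) S.
Variables (phi : T -> R) (phi2 : L2 mu phi).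
Implicit Types (f g u v : T -> R) (s t : R).

Let linL2 : lin_closed (L2 mu) := L2_lin mu.

(* S t is unspecified for t <= 0; this extension makes orbits continuous on the
   whole line. *)
Definition semigroup_ext t f : T -> R := if 0 < t then S t f else f.

(** Pairing with a fixed [phi] replaces vector-valued calculus by calculus of real functions. *)
Definition orbit f t : R := inner mu (semigroup_ext t f) phi.

Lemma semigroup_ext_L2 t f : L2 mu f -> L2 mu (semigroup_ext t f).
Proof.
move=> f2; rewrite /semigroup_ext; case: ifPn => // t0.
exact: (linear_op_maps (C0_semigroup_linear C0S t0) f2).
Qed.

Lemma orbit_linear t : linear_on (L2 mu) (orbit ^~ t).
Proof.
move=> a u v u2 v2; rewrite /orbit -(semi_inner_linear (inner_semi mu))//.
- have uv2 := linL2.2 a _ _ u2 v2.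
  apply: inner_ae => //.
  + exact: semigroup_ext_L2.
  + by apply: linL2.2; exact: semigroup_ext_L2.
  + rewrite /semigroup_ext; case: ifPn => [t0|_]; last exact: ae_eq_refl.
    exact: (linear_opP (C0_semigroup_linear C0S t0)).
  + exact: ae_eq_refl.
- exact: semigroup_ext_L2.
- exact: semigroup_ext_L2.
Qed.

Lemma orbit_ae f g t : L2 mu f -> L2 mu g -> f = g %[ae mu] ->
  orbit f t = orbit g t.
Proof.
move=> f2 g2 fg; apply: inner_ae => //.
- exact: semigroup_ext_L2.
- exact: semigroup_ext_L2.
- rewrite /semigroup_ext; case: ifPn => // t0.
  exact: (linear_op_ae (C0_semigroup_linear C0S t0)).
- exact: ae_eq_refl.
Qed.

Lemma orbit_le f t : L2 mu f -> `|orbit f t| <= norm2 mu f * norm2 mu phi.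
Proof.
move=> f2; apply: le_trans (inner_norm2 (semigroup_ext_L2 t f2) phi2) _.
rewrite ler_wpM2r ?norm2_ge0// /semigroup_ext; case: ifPn => // t0.
exact: contrS.
Qed.

Lemma orbitD f t h : L2 mu f -> 0 <= t -> 0 < h ->
  orbit f (t + h) = orbit (S h f) t.
Proof.
move=> f2 t0 h0.
have Sh2 := linear_op_maps (C0_semigroup_linear C0S h0) f2.
rewrite /orbit /semigroup_ext ltr_wpDl//.
case: ifPn => [t1|]; last first.
  rewrite -leNgt => t1; have -> : t = 0 by apply/eqP; rewrite eq_le t1.
  by rewrite add0r.
apply: inner_ae => //.
- exact: (linear_op_maps (C0_semigroup_linear C0S (addr_gt0 t1 h0)) f2).
- exact: (linear_op_maps (C0_semigroup_linear C0S t1) Sh2).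
- exact: (C0_semigroup_law C0S).
- exact: ae_eq_refl.
Qed.

(** By the semigroup law and contraction, an increment of length [h] is at most [|S h f - f| |phi|],
    whatever the base point. *)
Lemma orbit_continuous f : L2 mu f -> continuous (orbit f).
Proof.
move=> f2 s.
have mod0 : norm2 mu (S h f - f) * norm2 mu phi @[h --> 0^'+] --> 0 * norm2 mu phi.
  by apply: cvgMl; exact: (C0_semigroup_cvg C0S f2).
have step t h : 0 <= t -> 0 < h ->
    `|orbit f (t + h) - orbit f t| <= norm2 mu (S h f - f) * norm2 mu phi.
  move=> t0 h0; have Sh2 := linear_op_maps (C0_semigroup_linear C0S h0) f2.
  rewrite orbitD// -(linear_onB linL2 (orbit_linear t))//.
  by apply: orbit_le; exact: (lin_closedB linL2).
have orbit_neg t : t <= 0 -> orbit f t = orbit f 0.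
  by move=> t0; rewrite /orbit /semigroup_ext ltNge t0 ltxx.
apply/cvgrPdist_le => e e0.
move: mod0; rewrite mul0r => /cvgrPdist_le/(_ _ e0).
rewrite /at_right near_withinE => -[/= r r0 rP].
have le_step t t' : t <= t' -> t' - t < r -> `|orbit f t' - orbit f t| <= e.
  move=> tt' tr; have [t'0|t'0] := leP t' 0.
    by rewrite !orbit_neg ?(le_trans tt')// subrr normr0 ltW.
  (* The orbit is constant for nonpositive times, so a negative [t] can be moved up to 0, which
     shortens the increment. *)
  pose m := Num.max t 0.
  have -> : orbit f t = orbit f m.
    by rewrite /m; case: (leP t 0) => // t0; rewrite orbit_neg.
  have m0 : 0 <= m by rewrite le_max lexx orbT.
  have [->|mt'] := eqVneq m t'; first by rewrite subrr normr0 ltW.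
  have h0 : 0 < t' - m by rewrite subr_gt0 lt_neqAle mt' ge_max tt' ltW.
  have hr : t' - m < r.
    by apply: le_lt_trans tr; rewrite lerD2l lerN2 le_max lexx.
  have := step m (t' - m) m0 h0; rewrite (_ : m + (t' - m) = t'); last by ring.
  move=> /le_trans; apply.
  have := rP (t' - m); rewrite /ball /= !sub0r !normrN (gtr0_norm h0).
  by move=> /(_ hr h0) /ler_normlW.
near=> t; have : `|s - t| < r by near: t; exists r.
have [st|/ltW ts] := leP s t.
  by rewrite distrC ger0_norm ?subr_ge0// => str; rewrite distrC le_step.
by rewrite ger0_norm ?subr_ge0// => str; rewrite le_step.
Unshelve. all: by end_near. Qed.

(** The error of the linear approximation over a step [h] is [h] times the orbit of
    [h^-1 (S h u - u) - v], which contraction bounds uniformly in the base point. *)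
Lemma orbit_derive u v s : L2 mu u -> generator_limit mu S u v -> 0 < s ->
  is_derive s 1 (orbit u) (orbit v s).
Proof.
move=> u2 [v2 uv] s0.
apply: (@is_derive_of_modulus _ _ _
  (fun h => norm2 mu (h^-1 *: (S h u - u) - v) * norm2 mu phi)) => //.
- exact: orbit_continuous.
- by rewrite -[X in _ --> X](mul0r (norm2 mu phi)); exact: cvgMl.
- move=> t h t0 h0; have Sh2 := linear_op_maps (C0_semigroup_linear C0S h0) u2.
  have Su2 := lin_closedB linL2 Sh2 u2.
  have hSu2 := lin_closedZ linL2 h^-1 Su2.
  have w2 := lin_closedB linL2 hSu2 v2.
  rewrite orbitD// -(linear_onB linL2 (orbit_linear t))//.
  rewrite -(linear_onZ linL2 (orbit_linear t) h)// -(linear_onB linL2 (orbit_linear t))//.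
    rewrite (_ : _ - h *: v = h *: (h^-1 *: (S h u - u) - v)); last first.
      by rewrite scalerBr scalerA divff ?gt_eqF// scale1r.
    rewrite (linear_onZ linL2 (orbit_linear t))// normrM gtr0_norm//.
    by rewrite ler_pM2l//; exact: orbit_le.
  exact: (lin_closedZ linL2).
Qed.

(** As [v = a u - g], the derivative of [- e^{-at} (S_t u, phi)] is [e^{-at} (S_t g, phi)], and the
    fundamental theorem of calculus applies. The case of interest is [u = G a g]. *)
Lemma orbit_laplace u v g (a N : R) : L2 mu u -> L2 mu g ->
  generator_limit mu S u v -> v = a *: u - g %[ae mu] -> 0 < N ->
  \int[lebesgue_measure]_(t in `[0, N]) (expR (- a * t) * orbit g t) =
  inner mu u phi - expR (- a * N) * orbit u N.
Proof.
move=> u2 g2 uv vE N0; have [v2 _] := uv.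
pose H t := - (expR (- a * t) * orbit u t).
have orbit_v t : orbit v t = a * orbit u t - orbit g t.
  have au2 := lin_closedZ linL2 a u2.
  rewrite (orbit_ae t v2 (lin_closedB linL2 au2 g2) vE).
  by rewrite (linear_onB linL2 (orbit_linear t))// (linear_onZ linL2 (orbit_linear t)).
have derH t : 0 < t -> is_derive t 1 H (expR (- a * t) * orbit g t).
  move=> t0; have du := orbit_derive u2 uv t0.
  have de : is_derive t 1 (fun t => expR (- a * t)) (- a * expR (- a * t)).
    by apply: is_derive_eq; rewrite /GRing.scale /=; ring.
  by apply: is_derive_eq; rewrite orbit_v /GRing.scale /=; ring.
have cH : continuous H.
  move=> t; apply: cvgN; apply: cvgM; first exact: continuous_expRM.
  exact: orbit_continuous.
rewrite /Rintegral (@continuous_FTC2 _ _ H)//.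
- by rewrite /= /H mulr0 expR0 mul1r /orbit /semigroup_ext ltxx; ring.
- apply: continuous_subspaceT => t; apply: cvgM; first exact: continuous_expRM.
  exact: orbit_continuous.
- split.
  + by move=> t; rewrite in_itv /= => /andP[/derH[]].
  + exact/cvg_at_right_filter/cH.
  + exact/cvg_at_left_filter/cH.
- by move=> t; rewrite in_itv /= => /andP[/derH[_ dt] _]; rewrite derive1E.
Qed.

End Semigroup.

(** * Comparison of functions through integrals over sets of finite measure *)

Section Localization.
Context (d : measure_display) (T : measurableType d) (R : realType).
Variable mu : {measure set T -> \bar R}.
Implicit Types (f g h : T -> R) (B : set T).

Lemma Rintegral_ae_ge0 f : measurable_fun setT f ->
  (\forall x \ae mu, 0 <= f x) -> 0 <= \int[mu]_x f x.
Proof.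
move=> mf f0; rewrite (@ae_eq_Rintegral _ _ _ _ _ (fun x => `|f x|))//.
- by apply: Rintegral_ge0 => x _.
- exact: measurableT_comp.
- by apply: filterS f0 => x f0 _; rewrite ger0_norm.
Qed.

Lemma integrable_mul_indic f B : measurable B ->
  mu.-integrable setT (EFin \o (fun x => f x * \1_B x)) <->
  mu.-integrable B (EFin \o f).
Proof.
move=> mB; rewrite (_ : _ \o _ = (EFin \o f) \_ B).
  by split=> /(integrable_mkcond _ mB).
apply/funext => x; rewrite /= patchE indicE.
by case: ifPn => _; rewrite ?mulr1 ?mulr0.
Qed.

Lemma L2_integrable_on f B : measurable B -> (mu B < +oo)%E -> L2 mu f ->
  mu.-integrable B (EFin \o f).
Proof.
move=> mB Boo f2; apply/integrable_mul_indic => //.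
exact: (L2_mul_integrable f2 (indic_L2 mB Boo)).
Qed.

Lemma L1_integrable_on f B : measurable B -> L1 mu f ->
  mu.-integrable B (EFin \o f).
Proof. by move=> mB /L1P; apply: integrableS. Qed.

Lemma ae_bounded_integrable_on f B M : measurable B -> (mu B < +oo)%E ->
  measurable_fun setT f -> (\forall x \ae mu, `|f x| <= M) ->
  mu.-integrable B (EFin \o f).
Proof.
move=> mB Boo mf fM; apply/integrable_mul_indic => //.
apply: (@ae_le_integrable _ _ _ _ _ (fun x => M * \1_B x)).
- by apply: measurable_funM => //; exact: measurable_indic.
- by apply: (integrableZl measurableT M (f := EFin \o \1_B)); apply/L1P; exact: indic_L1.
- by apply: filterS fM => x fM; rewrite normrM [`|\1_B x|]ger0_norm// ler_wpM2r.
Qed.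

(** Time integrals lie in L^1, resolvents in L^2 and the potential is bounded; integrability on sets
    of finite measure is common to all three. *)
Lemma ae_le_test f g : sigma_finite setT mu ->
  measurable_fun setT f -> measurable_fun setT g ->
  (forall B, measurable B -> (mu B < +oo)%E ->
    [/\ mu.-integrable B (EFin \o f), mu.-integrable B (EFin \o g) &
        \int[mu]_(x in B) f x <= \int[mu]_(x in B) g x]) ->
  \forall x \ae mu, f x <= g x.
Proof.
move=> sfmu mf mg fg.
have : \forall x \ae mu, 0 <= g x - f x.
  apply: ae_all_ge0 => //; first exact: measurable_funB.
  move=> B mB Boo; have [fB gB fgB] := fg B mB Boo; split.
    exact: (integrableB _ gB fB).
  by rewrite RintegralB// subr_ge0.
by apply: filterS => x; rewrite subr_ge0.
Qed.

Lemma Lnormy_ae_bounded (w : T -> \bar R) : ('N[mu]_+oo[w] < +oo)%E ->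
  exists M : R, \forall x \ae mu, (`|w x| <= M%:E)%E.
Proof.
rewrite unlock; case: ifPn => [mu0|mu0 _]; last first.
  exists 0; exists setT; split => //; apply/eqP; rewrite eq_le measure_ge0 andbT.
  by rewrite leNgt.
have := ess_sup_ge mu (abse \o w); case: ess_sup => [r| |] wr.
- by move=> _; exists r.
- by rewrite ltxx.
- move=> _; exists 0; apply: filterS wr => x /=; rewrite leeNy_eq => /eqP ->.
  exact: leNye.
Qed.

End Localization.

Lemma expRN_small (R : realType) (N C a e : R) : 0 < a -> 0 < e ->
  exists2 N', N <= N' & expR (- a * N') * C <= e.
Proof.
(* Since [expR (a N') >= 1 + a N'], it suffices that [C <= a e N']. *)
move=> a0 e0; pose N' := Num.max N (Num.max 0 (C / (a * e))).
exists N'; first by rewrite le_max lexx.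
have N'0 : 0 <= N' by rewrite !le_max lexx orbT.
have CN' : C <= a * e * N'.
  by rewrite mulrC -ler_pdivrMr ?mulr_gt0// !le_max lexx !orbT.
have [C0|C0] := leP C 0.
  by apply: le_trans (ltW e0); rewrite mulr_ge0_le0// expR_ge0.
have := expR_ge1Dx (a * N'); have := expR_gt0 (a * N').
rewrite mulNr expRN => p0 p1; rewrite mulrC ler_pdivrMr//.
nra.
Qed.

(** * Time integrals and resolvents of a nonnegative function *)

Section Potential.
Context (d : measure_display) (T : measurableType d) (R : realType).
Variable mu : {measure set T -> \bar R}.
Hypothesis sfmu : sigma_finite setT mu.
Variables G S S1 : R -> (T -> R) -> T -> R.
Hypothesis resG : is_C0_contraction_resolvent mu G.
Hypothesis semS : semigroup_of_resolvent mu G S.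
Hypothesis extS : is_L1_extension mu S S1.
Variable g : T -> R.
Hypothesis g1 : L1 mu g.
Hypothesis g2 : L2 mu g.
Hypothesis g_ge0 : \forall x \ae mu, 0 <= g x.

Let C0S : is_C0_semigroup mu (norm2 mu) (L2 mu) S. Proof. by case: semS. Qed.
Let contrS : is_contraction_family (norm2 mu) (L2 mu) S.
Proof. by case: semS. Qed.

(** Positivity is given for the L^1 extension [S1] and passes to [S] because [g] lies in both L^1
    and L^2. *)
Lemma orbit_ge0 B t : measurable B -> (mu B < +oo)%E ->
  0 <= orbit mu S \1_B g t.
Proof.
move=> mB Boo; have B2 := indic_L2 mB Boo; have St2 := semigroup_ext_L2 C0S t g2.
apply: Rintegral_ae_ge0.
  exact: (integrable_Rmeasurable (L2_mul_integrable St2 B2)).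
rewrite /semigroup_ext; case: ifPn => [t0|_].
  have T1_ge0 := L1_extension_positive extS t0 g1 g_ge0.
  have /ae_at T1E := L1_extension_eq extS t0 g1 g2.
  by move: T1_ge0 T1E; apply: filterS2 => x + <- => ?; rewrite mulr_ge0.
by apply: filterS g_ge0 => x ?; rewrite mulr_ge0.
Qed.

Let orbit_integrable B (a : R) N : measurable B -> (mu B < +oo)%E ->
  lebesgue_measure.-integrable `[0, N]
    (EFin \o (fun t => expR (- a * t) * orbit mu S \1_B g t)).
Proof.
move=> mB Boo; apply: continuous_compact_integrable.
  exact: segment_compact.
apply: continuous_subspaceT => t; apply: cvgM.
  exact: continuous_expRM.
exact: (orbit_continuous C0S contrS (indic_L2 mB Boo) g2).
Qed.

Let orbit_integrable1 B N : measurable B -> (mu B < +oo)%E ->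
  lebesgue_measure.-integrable `[0, N] (EFin \o orbit mu S \1_B g).
Proof.
move=> mB Boo; apply: continuous_compact_integrable; first exact: segment_compact.
apply: continuous_subspaceT.
exact: (orbit_continuous C0S contrS (indic_L2 mB Boo) g2).
Qed.

(** Testing the time integral against the indicator of [B] produces the orbit. The null endpoint 0
    is added to work on a compact interval, where the continuous orbit is integrable. *)
Lemma time_integralE B N h : measurable B -> (mu B < +oo)%E ->
  is_time_integral mu S1 g N h ->
  \int[mu]_(x in B) h x =
  \int[lebesgue_measure]_(t in `[0, N]) orbit mu S \1_B g t.
Proof.
move=> mB Boo [h1 /(_ _ (indic_Loo mu mB))[_]].
rewrite Rintegral_mul_indic// => ->.
transitivity (\int[lebesgue_measure]_(t in `]0, N]) orbit mu S \1_B g t).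
  apply: eq_Rintegral => t; rewrite inE /= in_itv /= => /andP[t0 _].
  have T1g := linear_op_maps (L1_extension_linear extS t0) g1.
  have Tg := linear_op_maps (C0_semigroup_linear C0S t0) g2.
  rewrite /orbit /semigroup_ext t0; apply: ae_eq_Rintegral.
  - apply: measurable_funM; [exact: Lp_measurable T1g|exact: measurable_indic].
  - apply: measurable_funM; [exact: Lp_measurable Tg|exact: measurable_indic].
  - apply: filterS (L1_extension_eq extS t0 g1 g2) => x /(_ I) + _.
    by move=> ->.
rewrite Rintegral_itv_obnd_cbnd//; apply: integrableS (orbit_integrable1 N mB Boo) => //.
by apply: subset_itvr; rewrite bnd_simp.
Qed.

(** By contraction, [e^{-aN} C] bounds the boundary term left when the Laplace transform is cut at
    [N]; [K] is the truncated transform. *)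
Let C B a : R := norm2 mu (G a g) * norm2 mu \1_B.
Let K B a N : R := \int[lebesgue_measure]_(t in `[0, N])
  (expR (- a * t) * orbit mu S \1_B g t).

Let resolvent_laplace B a N : measurable B -> (mu B < +oo)%E ->
  0 < a -> 0 < N ->
  `|\int[mu]_(x in B) G a g x - K B a N| <= expR (- a * N) * C B a.
Proof.
move=> mB Boo a0 N0; have B2 := indic_L2 mB Boo.
have [_ _ [D [L [genL [DE Dlim]]]]] := semS.
have [Du Lu2 LuE] := resolvent_generatorE resG genL a0 g2.
have u2 := linear_op_maps (resolvent_linear resG a0) g2.
rewrite /K (orbit_laplace C0S contrS B2 u2 g2 (Dlim _ Du) LuE N0).
rewrite -(Rintegral_mul_indic _ _ mB) -/(inner mu _ _) opprB addrC subrK.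
rewrite normrM (gtr0_norm (expR_gt0 _)) ler_wpM2l ?expR_ge0//.
exact: (orbit_le C0S contrS B2 N u2).
Qed.

(** The integrand is nonnegative, so [K] increases with [N]; passing to a large [N'] makes the
    boundary term as small as desired. *)
Let le_resolvent_laplace B a N : measurable B -> (mu B < +oo)%E ->
  0 < a -> 0 < N -> K B a N <= \int[mu]_(x in B) G a g x.
Proof.
move=> mB Boo a0 N0; apply/ler_addgt0Pr => e e0.
have [N' NN' eN'] := expRN_small N (C B a) a0 e0.
have N'0 : 0 < N' := lt_le_trans N0 NN'.
apply: (@le_trans _ _ (K B a N')); last first.
  by have /ler_normlP[] := resolvent_laplace mB Boo a0 N'0; lra.
rewrite /K /Rintegral fine_le//.
- by apply: integrable_fin_num => //; exact: orbit_integrable.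
- by apply: integrable_fin_num => //; exact: orbit_integrable.
apply: ge0_subset_integral => //.
- exact: (measurable_int lebesgue_measure (orbit_integrable a N' mB Boo)).
- by move=> t _; rewrite lee_fin mulr_ge0 ?expR_ge0// orbit_ge0.
- by apply: subset_itvl; rewrite bnd_simp.
Qed.

(** On [[0, N]] the weight [e^{-at}] lies between [e^{-aN}] and 1. The boundary term survives only
    in the upper bound. *)
Lemma time_integral_resolvent B a N h : measurable B -> (mu B < +oo)%E ->
  0 < a -> 0 < N -> is_time_integral mu S1 g N h ->
  expR (- a * N) * \int[mu]_(x in B) h x <= \int[mu]_(x in B) G a g x /\
  \int[mu]_(x in B) G a g x <= \int[mu]_(x in B) h x +
    expR (- a * N) * (norm2 mu (G a g) * norm2 mu \1_B).
Proof.
move=> mB Boo a0 N0 hN; rewrite (time_integralE mB Boo hN).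
set F := orbit mu S \1_B g.
have intF := orbit_integrable1 N mB Boo.
have intK := orbit_integrable a N mB Boo.
have F_ge0 t : 0 <= F t := orbit_ge0 t mB Boo.
have /ler_normlP[uK1 uK2] := resolvent_laplace mB Boo a0 N0.
split.
  apply: le_trans (le_resolvent_laplace mB Boo a0 N0).
  rewrite -RintegralZl//; apply: le_Rintegral => //.
    exact: (integrableZl _ (expR (- a * N)) intF).
  move=> t /=; rewrite in_itv /= => /andP[t0 tN].
  by rewrite ler_wpM2r// ler_expR !mulNr lerN2 ler_pM2l.
have : K B a N <= \int[lebesgue_measure]_(t in `[0, N]) F t.
  apply: le_Rintegral => // t /=; rewrite in_itv /= => /andP[t0 tN].
  by rewrite ler_piMl// -expR0 ler_expR mulNr oppr_le0 mulr_ge0// ltW.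
by rewrite /C in uK1 uK2; lra.
Qed.

Lemma time_integral_ge0 N h : is_time_integral mu S1 g N h ->
  \forall x \ae mu, 0 <= h x.
Proof.
move=> hN; have [h1 _] := hN.
apply: ae_all_ge0 => //; first exact: Lp_measurable h1.
move=> B mB Boo; split; first exact: L1_integrable_on.
rewrite (time_integralE mB Boo hN).
by apply: Rintegral_ge0 => t _; exact: orbit_ge0.
Qed.

Lemma le_time_integral N N' h h' : N <= N' ->
  is_time_integral mu S1 g N h -> is_time_integral mu S1 g N' h' ->
  \forall x \ae mu, h x <= h' x.
Proof.
move=> NN' hN hN'; have [h1 _] := hN; have [h1' _] := hN'.
apply: ae_le_test => //; [exact: Lp_measurable h1|exact: Lp_measurable h1'|].
move=> B mB Boo; split; [exact: L1_integrable_on|exact: L1_integrable_on|].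
rewrite (time_integralE mB Boo hN) (time_integralE mB Boo hN').
rewrite /Rintegral fine_le//.
- by apply: integrable_fin_num => //; exact: orbit_integrable1.
- by apply: integrable_fin_num => //; exact: orbit_integrable1.
apply: ge0_subset_integral => //.
- exact: (measurable_int lebesgue_measure (orbit_integrable1 N' mB Boo)).
- by move=> t _; rewrite lee_fin orbit_ge0.
- by apply: subset_itvl; rewrite bnd_simp.
Qed.

Lemma time_integral_le_resolvent a N h : 0 < a -> 0 < N ->
  is_time_integral mu S1 g N h ->
  \forall x \ae mu, expR (- a * N) * h x <= G a g x.
Proof.
move=> a0 N0 hN; have [h1 _] := hN.
have u2 := linear_op_maps (resolvent_linear resG a0) g2.
have mh := Lp_measurable h1.
apply: ae_le_test => //; [exact: measurable_funM|exact: Lp_measurable u2|].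
move=> B mB Boo; have hB := L1_integrable_on mB h1; split.
- exact: (integrableZl _ (expR (- a * N)) hB).
- exact: L2_integrable_on.
- by rewrite RintegralZl//; exact: (time_integral_resolvent mB Boo a0 N0 hN).1.
Qed.

(** * Convergence of the resolvents to a bounded potential *)

Section Bounded.
Variables (h : T -> R) (M : R) (I : nat -> T -> R).
Hypothesis mh : measurable_fun setT h.
Hypothesis hM : \forall x \ae mu, `|h x| <= M.
Hypothesis intI : forall n, is_time_integral mu S1 g n%:R (I n).
Hypothesis Ih : \forall x \ae mu, I n x @[n --> \oo] --> h x.

Lemma time_integral_le_potential : \forall x \ae mu, forall n, I n x <= h x.
Proof.
have : \forall x \ae mu, forall n, I n x <= I n.+1 x.
  apply: ae_foralln => n; apply: le_time_integral (intI n) (intI n.+1).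
  by rewrite ler_nat.
move: Ih; apply: filterS2 => x cvI /nondecreasing_seqP ndI n.
rewrite -(cvg_lim _ cvI)//; apply: nondecreasing_cvgn_le => //.
by apply/cvg_ex; exists (h x).
Qed.

(** For each test set [B], a large time [n] makes the boundary term smaller than [e], while the time
    integrals stay below [h]. *)
Lemma resolvent_le_potential a : 0 < a -> \forall x \ae mu, G a g x <= h x.
Proof.
move=> a0; have u2 := linear_op_maps (resolvent_linear resG a0) g2.
apply: ae_le_test => //; first exact: Lp_measurable u2.
move=> B mB Boo; have hB := ae_bounded_integrable_on mB Boo mh hM; split => //.
  exact: L2_integrable_on.
apply/ler_addgt0Pr => e e0.
have [N' N'1 eN'] := expRN_small 1 (C B a) a0 e0.
have [n nN'] : exists n : nat, N' <= n%:R.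
  by exists (Num.trunc N').+1; apply/ltW/truncnS_gt.
have n0 : 0 < n%:R :> R := lt_le_trans (lt_le_trans ltr01 N'1) nN'.
have [_] := time_integral_resolvent mB Boo a0 n0 (intI n).
move=> /le_trans; apply; apply: lerD.
  have [In1 _] := intI n; have InB := L1_integrable_on mB In1.
  rewrite -(Rintegral_mul_indic _ _ mB) -[leRHS](Rintegral_mul_indic _ _ mB).
  apply: ae_le_Rintegral.
  - exact/integrable_mul_indic.
  - exact/integrable_mul_indic.
  - apply: filterS time_integral_le_potential => x Inh.
    by rewrite ler_wpM2r.
apply: le_trans eN'; rewrite ler_wpM2r ?mulr_ge0 ?norm2_ge0//.
by rewrite ler_expR !mulNr lerN2 ler_pM2l.
Qed.

Lemma resolvent_ge0 a : 0 < a -> \forall x \ae mu, 0 <= G a g x.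
Proof.
move=> a0; have := time_integral_le_resolvent a0 ltr01 (intI 1).
apply: filterS2 (time_integral_ge0 (intI 1)) => x I0; apply: le_trans.
by rewrite mulr_ge0// expR_ge0.
Qed.

(** Sandwich [e^{-ak} I_k <= G a g <= h]: first [k] is fixed with [I_k] close to [h], then [a] tends
    to 0. The index is shifted to [k.+1] because the lower bound is stated for positive times. *)
Lemma resolvent_ae_cvg (a : nat -> R) : (forall n, 0 < a n) ->
  a n @[n --> \oo] --> 0 ->
  \forall x \ae mu, G (a n) g x @[n --> \oo] --> h x.
Proof.
move=> a0 cva.
have leh : \forall x \ae mu, forall n, G (a n) g x <= h x.
  by apply: ae_foralln => n; exact: resolvent_le_potential.
have geI : \forall x \ae mu, forall n k : nat,
    expR (- a n * k.+1%:R) * I k.+1 x <= G (a n) g x.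
  apply: ae_foralln => n; apply: ae_foralln => k.
  by apply: time_integral_le_resolvent => //; rewrite ltr0n.
move: leh geI Ih; apply: filterS3 => x leh geI cvI.
apply/cvgrPdist_lt => e e0; have e20 : 0 < e / 2 by rewrite divr_gt0.
have /cvgrPdist_lt/(_ _ e20)[k _ kP] := cvI.
have := kP k.+1 (leqnSn k) => /ltr_normlW hI.
have cvE : expR (- a n * k.+1%:R) * I k.+1 x @[n --> \oo] -->
    expR (- 0 * k.+1%:R) * I k.+1 x.
  apply: cvgMl.
  rewrite (_ : (fun n => _) = (fun t => expR (- k.+1%:R * t)) \o a); last first.
    by apply/funext => n /=; rewrite !mulNr mulrC.
  rewrite oppr0 mul0r -(mulr0 (- k.+1%:R)).
  by apply: (cvg_comp _ _ cva); exact: continuous_expRM.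
move: cvE; rewrite oppr0 mul0r expR0 mul1r => /cvgrPdist_lt/(_ _ e20) cvE.
near=> n; rewrite ger0_norm ?subr_ge0//.
have : `|I k.+1 x - expR (- a n * k.+1%:R) * I k.+1 x| < e / 2.
  by near: n; exact: cvE.
move=> /ltr_normlW; have := geI n k; lra.
Unshelve. all: by end_near. Qed.

(** Since [0 <= G a g <= h <= M], the function [M |phi|] dominates; the limit at [0^'+] is tested
    along sequences. *)
Lemma resolvent_integral_cvg phi : L1 mu phi ->
  \int[mu]_x (G a g x * phi x) @[a --> 0^'+] --> \int[mu]_x (h x * phi x).
Proof.
move=> phi1; have mphi := Lp_measurable phi1.
apply/cvg_at_rightP => a [a0 cva].
have mG n : measurable_fun setT (G (a n) g).
  exact: Lp_measurable (linear_op_maps (resolvent_linear resG (a0 n)) g2).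
have leM : \forall x \ae mu, forall n, `|G (a n) g x| <= M.
  apply: ae_foralln => n; move: hM (resolvent_le_potential (a0 n)) (resolvent_ge0 (a0 n)).
  apply: filterS3 => x hx Gh G0; rewrite ger0_norm//.
  exact: le_trans Gh (le_trans (ler_norm _) hx).
have := @dominated_convergence _ _ _ mu setT measurableT
  (fun n x => (G (a n) g x * phi x)%:E) (fun x => (h x * phi x)%:E)
  (fun x => (M * `|phi x|)%:E).
case.
- by move=> n; apply/measurable_EFinP; exact: measurable_funM.
- by apply/measurable_EFinP; exact: measurable_funM.
- apply: filterS (resolvent_ae_cvg a0 cva) => x cvx _.
  by apply: cvg_EFin; [exact: nearW|exact: cvgMl].
- have /L1P phii := phi1.
  exact: (integrableZl measurableT M (integrable_abse phii)).
- by apply: filterS leM => x leM n _; rewrite lee_fin normrM ler_wpM2r.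
move=> hphi _ cv; rewrite /Rintegral.
apply: fine_cvg; rewrite fineK//; exact: integrable_fin_num hphi.
Qed.

End Bounded.
End Potential.

(** * Cauchy sequences of near-minimisers in decreasing midpoint-convex sets *)

Section Mazur.
Context (R : realType) (X : lmodType R) (D : set X) (B : X -> X -> R).
Hypothesis siB : semi_inner D B.
Implicit Types (u v : X).

Lemma parallelogram u v : D u -> D v ->
  B (u - v) (u - v) =
  2 * B u u + 2 * B v v - 4 * B (2^-1 *: (u + v)) (2^-1 *: (u + v)).
Proof.
move=> Du Dv; have linD := semi_inner_dom siB.
have Duv := lin_closedD linD Du Dv; have D0 := linD.1.
rewrite (semi_innerB siB)// -[2^-1 *: _]addr0 (semi_inner_expand siB)//.
have := semi_inner_expand siB 1 Du Dv; rewrite scale1r => ->.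
have B0 v' : D v' -> B v' 0 = 0.
  move=> Dv'; rewrite (semi_inner_sym siB)//.
  exact: (linear_on0 linD (semi_inner_linear siB Dv')).
by rewrite !B0//; field.
Qed.

(* z n is a near-minimiser of B on K n; these minima increase to a finite limit,
   so the parallelogram law makes z Cauchy. *)
Lemma mazur (K : nat -> set X) (C : R) :
  (forall n, K n `<=` D) -> (forall n, K n.+1 `<=` K n) ->
  (forall n u v, K n u -> K n v -> K n (2^-1 *: (u + v))) ->
  (forall n, exists2 u, K n u & B u u <= C) ->
  exists z : nat -> X, (forall n, K n (z n)) /\
    forall e : R, 0 < e -> exists n0 : nat, forall m n : nat,
      (n0 <= m)%N -> (n0 <= n)%N -> B (z m - z n) (z m - z n) < e.
Proof.
move=> KD Kdec Kmid KC.
pose Q n := [set B u u | u in K n]; pose dn n := inf (Q n).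
have hasQ n : has_inf (Q n).
  split; first by have [u Ku _] := KC n; exists (B u u), u.
  by exists 0 => _ [u Ku <-]; exact: (semi_inner_ge0 siB (KD n u Ku)).
have dle n u : K n u -> dn n <= B u u.
  by move=> Ku; apply: ge_inf; [case: (hasQ n)|exists u].
have Kle n m : (n <= m)%N -> K m `<=` K n.
  by move=> nm; rewrite -(subnKC nm); elim: (m - n)%N => [|k IH];
    rewrite ?addn0// addnS => u /Kdec/IH.
have nd_dn : nondecreasing_seq dn.
  move=> n m nm; apply: lb_le_inf; first by case: (hasQ m).
  by move=> _ [u Ku <-]; apply: dle; exact: Kle Ku.
have dC n : dn n <= C by have [u Ku] := KC n; apply: le_trans; exact: dle.
have inv0 n : 0 < n.+1%:R^-1 :> R by rewrite invr_gt0.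
have /choice[z zP] n : exists z, K n z /\ B z z < dn n + n.+1%:R^-1.
  by have [_ [u Ku <-] uP] := inf_adherent (inv0 n) (hasQ n); exists u.
exists z; split=> [n|e e0]; first by case: (zP n).
have cvd : dn n @[n --> \oo] --> sup (range dn).
  apply: nondecreasing_cvgn => //; exists C => _ [n _ <-]; exact: dC.
have ub n : dn n <= sup (range dn).
  by rewrite -(cvg_lim _ cvd)//; apply: nondecreasing_cvgn_le => //;
    apply/cvg_ex; exists (sup (range dn)).
(* With [s] the limit of the infima, the parallelogram law gives at most
   [4 (s - dn n0) + 2/(m+1) + 2/(n+1)], that is, eight terms each below [e / 8]. *)
have e80 : 0 < e / 8 by rewrite divr_gt0.
have /cvgrPdist_lt/(_ _ e80)[n1 _ n1P] := cvd.
have /cvgrPdist_lt/(_ _ e80)[n2 _ n2P] := @cvg_harmonic R.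
pose n0 := maxn n1 n2.
have h1 : sup (range dn) - dn n0 < e / 8.
  by have := n1P n0 (leq_maxl _ _); apply: le_lt_trans; exact: ler_norm.
have h2 n : (n0 <= n)%N -> n.+1%:R^-1 < e / 8.
  move=> n0n; have := n2P n (leq_trans (leq_maxr _ _) n0n).
  by rewrite /= sub0r normrN ger0_norm// invr_ge0.
exists n0 => m n n0m n0n.
have [Km zm] := zP m; have [Kn zn] := zP n.
rewrite parallelogram; [|exact: KD Km|exact: KD Kn].
have := dle _ _ (Kmid n0 _ _ (Kle _ _ n0m _ Km) (Kle _ _ n0n _ Kn)).
have := h2 _ n0m; have := h2 _ n0n; have := ub m; have := ub n.
move: zm zn h1; set a := m.+1%:R^-1; set b := n.+1%:R^-1.
lra.
Qed.

End Mazur.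

(** By completeness of the reals it is enough to be Cauchy at 0 from the right, a property stable
    under uniform approximation. *)
Lemma cvg_at_right_approx (R : realType) (F : R -> R) :
  (forall e : R, 0 < e -> exists2 F' : R -> R, cvg (F' a @[a --> 0^'+]) &
     forall a, 0 < a -> `|F a - F' a| <= e) ->
  cvg (F a @[a --> 0^'+]).
Proof.
move=> FF'; apply/cauchy_cvgP/cauchy_exP => e e0.
have e20 : 0 < e / 2 by rewrite divr_gt0.
have [F' /cvg_ex[l /cvgrPdist_lt/(_ _ e20) lF'] FF'e] := FF' _ e20.
exists l; rewrite /fmap /=; near=> a.
have : `|l - F' a| < e / 2 by near: a; exact: lF'.
have a0 : 0 < a by near: a; exact: nbhs_right_gt.
have := FF'e a a0 => h1 h2.
rewrite /ball /= -(subrKA (F' a)) (le_lt_trans (ler_normD _ _))//.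
by rewrite (distrC (F' a)); lra.
Unshelve. all: by end_near. Qed.

(** Projection onto [[0, 1]] brings no point farther from 0 or 1, the values of an indicator. *)
Lemma clamp_bool_dist (R : realFieldType) (y : R) (b : bool) :
  (Num.min (Num.max y 0) 1 - b%:R) ^+ 2 <= (y - b%:R) ^+ 2.
Proof.
have [y0|y0] := leP y 0.
  by rewrite (min_idPl _) ?ler01//; case: b; rewrite /=; nra.
by have [y1|y1] := leP y 1 => //; case: b; rewrite /=; nra.
Qed.

(** * Dirichlet forms: potentials of indicators and their density *)

Section DirichletForm.
Context (d : measure_display) (T : measurableType d) (R : realType).
Variable mu : {measure set T -> \bar R}.
Variables (V : set (T -> R)) (A : (T -> R) -> (T -> R) -> R).
Hypothesis formA : is_dirichlet_form mu V A.
Implicit Types (u v w : T -> R) (B : set T).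

(** Hilbert space arguments are applied to this symmetric part, which has the same diagonal as
    [A]. *)
Definition sym_form u v : R := (A u v + A v u) / 2.
Definition sym_form1 u v : R := sym_form u v + inner mu u v.

Lemma form_lin : lin_closed V.
Proof. by case: (form_subspace formA) => V0 VP _; split. Qed.

Lemma sym_formE u : sym_form u u = A u u.
Proof. by rewrite /sym_form; field. Qed.

Lemma sym_form_semi : semi_inner V sym_form.
Proof.
split; first exact: form_lin.
- move=> v Vv a u u' Vu Vu'; rewrite /sym_form (form_linear_l formA)//.
  by rewrite (form_linear_r formA)//; field.
- by move=> u v _ _; rewrite /sym_form addrC.
- by move=> u Vu; rewrite sym_formE; exact: (form_ge0 formA).
Qed.

Lemma sym_form1_semi : semi_inner V sym_form1.
Proof.
have L2V := form_sub formA.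
split; first exact: form_lin.
- move=> v Vv a u u' Vu Vu'; rewrite /sym_form1.
  rewrite (semi_inner_linear sym_form_semi)// (semi_inner_linear (inner_semi mu)).
  + by ring.
  + exact: L2V.
  + exact: L2V.
  + exact: L2V.
- by move=> u v Vu Vv; rewrite /sym_form1 innerC (semi_inner_sym sym_form_semi).
- move=> u Vu; rewrite addr_ge0//; first exact: (semi_inner_ge0 sym_form_semi).
  exact: (semi_inner_ge0 (inner_semi mu) (L2V _ Vu)).
Qed.

Lemma form_normE u : form_norm mu A u = semi_norm sym_form1 u.
Proof. by rewrite /form_norm /semi_norm /sym_form1 sym_formE. Qed.

Lemma norm2_le_semi_norm u : V u -> norm2 mu u <= semi_norm sym_form1 u.
Proof.
move=> Vu; rewrite norm2E; last exact: (form_sub formA).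
by rewrite ler_wsqrtr// lerDr (semi_inner_ge0 sym_form_semi).
Qed.

Lemma sym_norm_le_semi_norm u : V u -> Num.sqrt (A u u) <= semi_norm sym_form1 u.
Proof.
move=> Vu; rewrite ler_wsqrtr// /sym_form1 sym_formE lerDl.
exact: (semi_inner_ge0 (inner_semi mu) (form_sub formA Vu)).
Qed.

(** Only limits already in [V] are considered; completeness of [V] supplies them, so Riesz
    representation holds on [S]. *)
Definition form_closed (S : set (T -> R)) := [/\ S `<=` V, lin_closed S &
  forall (u : nat -> T -> R) v, (forall n, S (u n)) -> V v ->
    semi_norm sym_form1 (u n - v) @[n --> \oo] --> 0 -> S v].

Lemma form_riesz S (l : (T -> R) -> R) (c : R) : form_closed S ->
  linear_on S l -> (forall w, S w -> `|l w| <= c * semi_norm sym_form1 w) ->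
  exists2 r, S r & forall w, S w -> l w = sym_form1 r w.
Proof.
move=> [SV linS closS] linl bl.
apply: (riesz sym_form1_semi SV linS linl bl) => u Su cu.
have [|w Vw uw] := form_complete formA (fun n => SV _ (Su n)).
  move=> e /cu[n0 n0P]; exists n0 => m n mn0 nn0.
  by rewrite form_normE; exact: n0P.
have {}uw : semi_norm sym_form1 (u n - w) @[n --> \oo] --> 0.
  by under eq_fun do rewrite -form_normE.
by exists w => //; exact: closS uw.
Qed.

Lemma form_closedT : form_closed V.
Proof. by split=> //; exact: form_lin. Qed.

(* r is the 1-potential of \1_B for the symmetric part of A: the Riesz
   representative of (\1_B, .) in V. *)
Definition represents_indic B r :=
  V r /\ forall w, V w -> inner mu \1_B w = sym_form1 r w.

Lemma represents_indic_ex B : measurable B -> (mu B < +oo)%E ->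
  exists r, represents_indic B r.
Proof.
move=> mB Boo; have B2 := indic_L2 mB Boo; have L2V := form_sub formA.
have [||r Vr rP] := @form_riesz V (inner mu \1_B) (norm2 mu \1_B) form_closedT.
- move=> a u v Vu Vv; rewrite !(innerC mu \1_B).
  by rewrite (semi_inner_linear (inner_semi mu))//; exact: L2V.
- move=> w Vw; apply: le_trans (inner_norm2 B2 (L2V _ Vw)) _.
  by rewrite ler_wpM2l ?norm2_ge0// norm2_le_semi_norm.
by exists r.
Qed.

(** In the sum of the two contraction inequalities the cross terms cancel, leaving twice
    [A u u - A U U >= 0]. *)
Lemma unit_contraction_form u : V u ->
  A (unit_contraction u) (unit_contraction u) <= A u u.
Proof.
move=> Vu; have VU := form_contraction formA Vu.
have linV := form_lin.
have := form_contraction_l formA Vu; have := form_contraction_r formA Vu.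
set U := unit_contraction u in VU *.
have linl w (Vw : V w) : linear_on V (A ^~ w).
  by move=> a ? ? ? ?; rewrite (form_linear_l formA).
have linr w (Vw : V w) : linear_on V (A w).
  by move=> a ? ? ? ?; rewrite (form_linear_r formA).
have VUD := lin_closedD linV Vu VU; have VUB := lin_closedB linV Vu VU.
rewrite (linear_onB linV (linl _ VUD))//.
rewrite (linear_onD (linr _ Vu))// (linear_onD (linr _ VU))//.
rewrite (linear_onD (linl _ VUB))//.
rewrite (linear_onB linV (linr _ Vu))// (linear_onB linV (linr _ VU))//.
lra.
Qed.

(** The potential [r] is the unique minimiser, up to a.e. equality, of [A w w + |w - 1_B|^2] over
    [V]. Clamping to [[0, 1]] increases neither term, so [r] equals its own clamp a.e. *)
Lemma represents_indic_unit B r : measurable B -> (mu B < +oo)%E ->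
  represents_indic B r -> \forall x \ae mu, 0 <= r x <= 1.
Proof.
move=> mB Boo [Vr rP]; have L2V := form_sub formA.
have B2 := indic_L2 mB Boo.
pose U := unit_contraction r; have VU : V U := form_contraction formA Vr.
have r2 := L2V _ Vr; have U2 := L2V _ VU; have linL2 := L2_lin mu.
have si := inner_semi mu.
have le_dist : inner mu (U - \1_B) (U - \1_B) <= inner mu (r - \1_B) (r - \1_B).
  have UB2 := lin_closedB linL2 U2 B2; have rB2 := lin_closedB linL2 r2 B2.
  apply: le_Rintegral => //; [exact: L2_mul_integrable|exact: L2_mul_integrable|].
  move=> x _; rewrite !fctE -!expr2 /U /unit_contraction indicE.
  exact: clamp_bool_dist.
have := unit_contraction_form Vr; rewrite -/U => le_form.
(* Completing the square: this value is the excess at [U] of the minimised functional over its value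
   at [r]. *)
have : sym_form1 (U - r) (U - r) <= 0.
  rewrite (semi_innerB sym_form1_semi)//.
  rewrite (semi_inner_sym sym_form1_semi VU Vr) -(rP _ VU).
  have := rP _ Vr; move: le_dist; rewrite !(semi_innerB si)//.
  rewrite /sym_form1 !sym_formE (innerC mu U) (innerC mu r \1_B); lra.
have VUr := lin_closedB form_lin VU Vr.
rewrite /sym_form1 sym_formE => Ur0.
have Ur : U - r = 0 %[ae mu].
  apply: inner_eq0; first exact: (lin_closedB linL2).
  have := form_ge0 formA VUr; have := semi_inner_ge0 si (L2V _ VUr); lra.
apply: filterS Ur => x /(_ I) Urx.
have <- : U x = r x by apply/eqP; rewrite -subr_eq0; apply/eqP.
by rewrite /U /unit_contraction le_min le_max lexx orbT ler01 ge_min lexx orbT.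
Qed.

Hypothesis sfmu : sigma_finite setT mu.

(* If r' is the 1-potential of \1_F, then (r, \1_F) = (\1_B, r') <= mu B. *)
Lemma represents_indic_L1 B r : measurable B -> (mu B < +oo)%E ->
  represents_indic B r -> L1 mu r.
Proof.
move=> mB Boo rP; have r01 := represents_indic_unit mB Boo rP.
have [Vr rE] := rP; have r2 := form_sub formA Vr.
have mr := Lp_measurable r2.
have /sigma_finiteP[F [FT ndF Foo]] := sfmu.
apply/L1P/integrableP; split; first exact/measurable_EFinP.
rewrite FT; apply: (@le_lt_trans _ _ (mu B)) => //.
have mabs : measurable_fun setT (fun x => `|(EFin \o r) x|%E).
  by apply: measurableT_comp => //; exact/measurable_EFinP.
(* The bound [mu B] on each set of a finite-measure exhaustion passes to the whole space by monotone
   convergence. *)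
have cv := @ge0_nondecreasing_set_cvg_integral _ _ _ F
  (fun x => `|(EFin \o r) x|%E) mu ndF (fun n => (Foo n).1)
  (fun n => measurable_funS measurableT (@subsetT _ _) mabs)
  (fun n x _ => abse_ge0 _).
rewrite -(cvg_lim _ cv)//; apply: lime_le; first by apply/cvg_ex; eexists; exact: cv.
apply: nearW => n; have [mF Fnoo] := Foo n.
have [s [Vs sE]] := represents_indic_ex mF Fnoo.
have s01 := represents_indic_unit mF Fnoo (conj Vs sE).
have s2 := form_sub formA Vs.
have sF : \int[mu]_(x in F n) r x <= fine (mu B).
  rewrite -Rintegral_mul_indic// -/(inner mu r _) innerC sE//.
  rewrite (semi_inner_sym sym_form1_semi Vs Vr) -rE// innerC.
  rewrite -[leRHS]mul1r -(Rintegral_cst mu mB) -Rintegral_mul_indic//.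
  have B1 := indic_L1 mB Boo.
  apply: ae_le_Rintegral.
  - exact: (L2_mul_integrable s2 (indic_L2 mB Boo)).
  - apply/integrable_mul_indic => //.
    apply: (ae_bounded_integrable_on mB Boo (M := 1)) => //.
    by apply: nearW => x; rewrite normr1.
  - by apply: filterS s01 => x /andP[_ s1]; rewrite ler_wpM2r.
rewrite -[mu B]fineK ?ge0_fin_numE//.
apply: le_trans (_ : _ <= (\int[mu]_(x in F n) r x)%:E)%E _.
  have intr := L2_integrable_on mF Fnoo r2.
  rewrite /Rintegral fineK; last exact: integrable_fin_num.
  rewrite le_eqVlt; apply/orP; left; apply/eqP; apply: ae_eq_integral => //.
  - exact: measurable_funS mabs.
  - exact: (measurable_int mu intr).
  - by apply: filterS r01 => x /andP[r0 _] _; rewrite /= ger0_norm.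
by rewrite lee_fin.
Qed.

Lemma form_ae0 u v : V u -> V v -> u - v = 0 %[ae mu] ->
  semi_norm sym_form1 (u - v) = 0.
Proof.
move=> Vu Vv uv; have Vuv := lin_closedB form_lin Vu Vv.
have V0 := form_lin.1; have uv2 := form_sub formA Vuv.
have L20 := form_sub formA V0.
rewrite /semi_norm /sym_form1 sym_formE.
rewrite (form_ae formA Vuv V0 Vuv V0 uv uv) (inner_ae uv2 L20 uv2 L20 uv uv).
rewrite (linear_on0 form_lin (fun a u v Vu Vv => form_linear_l formA a Vu Vv V0)).
rewrite (linear_on0 (L2_lin mu) (semi_inner_linear (inner_semi mu) L20)).
by rewrite addr0 sqrtr0.
Qed.

(** Let [r] in [S] represent the pairing with [v], as an orthogonal projection would. Testing on
    potentials of indicators shows that [v] and [r] have equal integrals over all sets of finite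
    measure, hence agree a.e. *)
Lemma form_density S : form_closed S ->
  (forall B r, measurable B -> (mu B < +oo)%E -> represents_indic B r -> S r) ->
  V `<=` S.
Proof.
move=> closS SB v Vv; have [SV linS lim_S] := closS.
have si := sym_form1_semi; have L2V := form_sub formA.
have [||r Sr rE] := @form_riesz S (sym_form1 v) (semi_norm sym_form1 v) closS.
- move=> a u w Su Sw; rewrite (semi_innerZDr si)//; exact: SV.
- by move=> w Sw; apply: (semi_inner_CS si) => //; exact: SV.
have Vr := SV _ Sr; have Vvr := lin_closedB form_lin Vv Vr.
have test B : measurable B -> (mu B < +oo)%E ->
    \int[mu]_(x in B) v x = \int[mu]_(x in B) r x.
  move=> mB Boo; have [s [Vs sE]] := represents_indic_ex mB Boo.
  have Ss := SB B s mB Boo (conj Vs sE).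
  rewrite -[LHS](Rintegral_mul_indic _ _ mB) -[RHS](Rintegral_mul_indic _ _ mB).
  rewrite -/(inner mu v _) -/(inner mu r _) innerC [RHS]innerC !sE//.
  by rewrite !(semi_inner_sym si Vs)//; exact: rE.
have v2 := L2V _ Vv; have r2 := L2V _ Vr.
have mv := Lp_measurable v2; have mr := Lp_measurable r2.
have vr : \forall x \ae mu, v x <= r x.
  apply: ae_le_test => // B mB Boo; split; [exact: L2_integrable_on..|].
  by rewrite test.
have rv : \forall x \ae mu, r x <= v x.
  apply: ae_le_test => // B mB Boo; split; [exact: L2_integrable_on..|].
  by rewrite test.
(* The constant sequence [r] converges to [v], their difference having norm 0. *)
apply: (lim_S (fun=> r)) => //.
rewrite form_ae0//; first exact: cvg_cst.
by move: vr rv; apply: filterS2 => x vr rv _; apply/eqP; rewrite subr_eq0 eq_le vr rv.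
Qed.

(** * Convergence of forms along a family of bounded energy *)

Section Convergence.
Variables (w : R -> T -> R) (C : R).
Hypothesis Vw : forall a, 0 < a -> V (w a).
Hypothesis wC : forall a, 0 < a -> A (w a) (w a) <= C.
Hypothesis cvg_w : forall phi, L1 mu phi -> L2 mu phi ->
  cvg (inner mu (w a) phi @[a --> 0^'+]).

Let sqrt_wC a : 0 < a -> Num.sqrt (sym_form (w a) (w a)) <= Num.sqrt C.
Proof. by move=> a0; rewrite sym_formE ler_wsqrtr// wC. Qed.

(** The [v] for which the limit exists form a closed subspace, by the energy bound. It contains
    every potential [r] of an indicator, as the form at [(w a, r)] equals
    [(w a, 1_B) - (w a, r)]. *)
Lemma sym_form_cvg v : V v -> cvg (sym_form (w a) v @[a --> 0^'+]).
Proof.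
have siA := sym_form_semi; have linV := form_lin.
pose S := [set v | V v /\ cvg (sym_form (w a) v @[a --> 0^'+])].
suff VS : V `<=` S by move=> /VS[].
have eq_at_right (F F' : R -> R) : (forall a, 0 < a -> F' a = F a) ->
    cvg (F a @[a --> 0^'+]) -> cvg (F' a @[a --> 0^'+]).
  move=> FF' cvF; apply: cvg_at_right_approx => e e0; exists F => // a a0.
  by rewrite FF'// subrr normr0 ltW.
apply: form_density; first split.
- by move=> u [].
- split.
    split; first exact: linV.1.
    apply: (eq_at_right (fun=> 0)); last exact: is_cvg_cst.
    move=> a a0; rewrite (semi_inner_sym siA (Vw a0) linV.1).
    exact: (linear_on0 linV (semi_inner_linear siA (Vw a0))).
  move=> c u v' [Vu cu] [Vv' cv']; split; first exact: linV.2.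
  apply: (eq_at_right (fun a => c * sym_form (w a) u + sym_form (w a) v')).
    by move=> a a0; rewrite (semi_innerZDr siA c Vu Vv' (Vw a0)).
  by apply: is_cvgD => //; apply: is_cvgMr.
- move=> u v' Su Vv' uv'; split => //; apply: cvg_at_right_approx => e e0.
  have C10 : 0 < Num.sqrt C + 1 by rewrite ltr_wpDl// sqrtr_ge0.
  (* The added 1 keeps the denominator positive when [C = 0]. *)
  have e'0 : 0 < e / (Num.sqrt C + 1) by rewrite divr_gt0.
  move/cvgrPdist_lt/(_ _ e'0) : uv' => [n _ /(_ n (leqnn n))] /=.
  rewrite sub0r normrN ger0_norm ?sqrtr_ge0// => un.
  exists (fun a => sym_form (w a) (u n)); first by case: (Su n).
  move=> a a0; have [Vun _] := Su n; have Vuv := lin_closedB linV Vun Vv'.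
  rewrite distrC.
  have -> : sym_form (w a) (u n) - sym_form (w a) v' = sym_form (w a) (u n - v').
    rewrite !(semi_inner_sym siA (Vw a0))//.
    by rewrite (linear_onB linV (semi_inner_linear siA (Vw a0))).
  apply: le_trans (semi_inner_CS siA (Vw a0) Vuv) _.
  apply: (@le_trans _ _ (Num.sqrt C * (e / (Num.sqrt C + 1)))).
    apply: ler_pM; rewrite ?sqrtr_ge0// ?sqrt_wC//.
    by rewrite sym_formE; apply: le_trans (sym_norm_le_semi_norm Vuv) (ltW un).
  by rewrite mulrCA ler_piMr ?(ltW e0)// ler_pdivrMr// mul1r lerDl.
- move=> B r mB Boo rP; have [Vr rE] := rP; split => //.
  have r1 := represents_indic_L1 mB Boo rP; have r2 := form_sub formA Vr.
  apply: (eq_at_right (fun a => inner mu (w a) \1_B - inner mu (w a) r)).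
    move=> a a0; rewrite (innerC mu _ \1_B) (rE _ (Vw a0)) /sym_form1.
    by rewrite (innerC mu r) (semi_inner_sym siA Vr (Vw a0)) addrK.
  apply: is_cvgB; apply: cvg_w => //; [exact: indic_L1|exact: indic_L2].
Qed.

(** Completeness of [V] is given for the norm including the L^2 part, whereas the energy bound
    concerns [A] alone. So the functional [A ^~ v] is represented only approximately through the
    symmetric part, with an error uniform in [a]. *)
Lemma form_cvg K v : (forall u u', V u -> V u' ->
    `|A u u'| <= K * Num.sqrt (A u u) * Num.sqrt (A u' u')) ->
  V v -> cvg (A (w a) v @[a --> 0^'+]).
Proof.
move=> AK Vv; have siA := sym_form_semi.
apply: cvg_at_right_approx => e e0.
have C10 : 0 < Num.sqrt C + 1 by rewrite ltr_wpDl// sqrtr_ge0.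
have e'0 : 0 < e / (Num.sqrt C + 1) by rewrite divr_gt0.
have linl : linear_on V (A ^~ v).
  by move=> c u u' Vu Vu'; rewrite (form_linear_l formA).
have bl u : V u -> `|A u v| <= K * Num.sqrt (A v v) * Num.sqrt (sym_form u u).
  by move=> Vu; rewrite sym_formE mulrAC; exact: AK.
have [r Vr rP] := approx_riesz siA (@subset_refl _ V) form_lin linl bl e'0.
exists (sym_form ^~ r \o w); first exact: sym_form_cvg.
move=> a a0; rewrite /= (semi_inner_sym siA (Vw a0) Vr).
apply: le_trans (rP _ (Vw a0)) _.
rewrite mulrAC ler_pdivrMr// ler_pM2l// (le_trans (sqrt_wC a0))//.
by rewrite lerDl.
Qed.

End Convergence.
End DirichletForm.

(** * Energy estimates for the resolvents and passage to the limit *)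

Section Main.
Context (d : measure_display) (T : measurableType d) (R : realType).
Variable mu : {measure set T -> \bar R}.
Hypothesis sfmu : sigma_finite setT mu.
Variables (G S S1 : R -> (T -> R) -> T -> R).
Hypothesis resG : is_C0_contraction_resolvent mu G.
Variables (DL : set (T -> R)) (L : (T -> R) -> T -> R).
Hypothesis genL : is_resolvent_generator mu G DL L.
Hypothesis semS : semigroup_of_resolvent mu G S.
Hypothesis extS : is_L1_extension mu S S1.
Variables (D0 : set (T -> R)) (E0 : (T -> R) -> (T -> R) -> R).
Hypothesis formE0 : is_sectorial_dirichlet_form mu D0 E0.
Hypothesis subE0 : bounded_part mu DL `<=` D0.
Hypothesis leE0 : forall u, bounded_part mu DL u -> E0 u u <= inner mu (- L u) u.
Variables (g h : T -> R) (M : R) (I : nat -> T -> R).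
Hypothesis g1 : L1 mu g.
Hypothesis g2 : L2 mu g.
Hypothesis g_ge0 : \forall x \ae mu, 0 <= g x.
Hypothesis mh : measurable_fun setT h.
Hypothesis hM : \forall x \ae mu, `|h x| <= M.
Hypothesis intI : forall n, is_time_integral mu S1 g n%:R (I n).
Hypothesis Ih : \forall x \ae mu, I n x @[n --> \oo] --> h x.

Let formD : is_dirichlet_form mu D0 E0 := formE0.1.

Let resolvent_L2 a : 0 < a -> L2 mu (G a g).
Proof. by move=> a0; exact: (linear_op_maps (resolvent_linear resG a0) g2). Qed.

Let le_potential a : 0 < a -> \forall x \ae mu, G a g x <= h x.
Proof.
by move=> a0; exact: (resolvent_le_potential sfmu resG semS extS g1 g2 g_ge0 mh
  hM intI Ih).
Qed.

Let ge0_resolvent a : 0 < a -> \forall x \ae mu, 0 <= G a g x.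
Proof.
by move=> a0; exact: (resolvent_ge0 sfmu resG semS extS g1 g2 g_ge0 intI).
Qed.

(** The bounds [0 <= G a g <= h <= M] place the resolvents where the decomposition of the form is
    available. *)
Lemma resolvent_bounded a : 0 < a -> bounded_part mu DL (G a g).
Proof.
move=> a0; have [Du _ _] := resolvent_generatorE resG genL a0 g2.
split => //; apply/LooP; split; first exact: Lp_measurable (resolvent_L2 a0).
exists M; move: hM (le_potential a0) (ge0_resolvent a0); apply: filterS3.
move=> x hx Gh G0; rewrite ger0_norm//.
exact: le_trans Gh (le_trans (ler_norm _) hx).
Qed.

Let resolvent_dom a : 0 < a -> D0 (G a g).
Proof. by move=> a0; apply: subE0; exact: resolvent_bounded. Qed.

Let innerNL a v : 0 < a -> L2 mu v ->
  inner mu (- L (G a g)) v = inner mu g v - a * inner mu (G a g) v.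
Proof.
move=> a0 v2; have [_ Lu2 LuE] := resolvent_generatorE resG genL a0 g2.
have linL2 := L2_lin mu; have u2 := resolvent_L2 a0.
have si := semi_inner_linear (inner_semi mu) v2.
have au2 := lin_closedZ linL2 a u2; have w2 := lin_closedB linL2 g2 au2.
have NLu2 : L2 mu (- L (G a g)).
  by rewrite -scaleN1r; exact: (lin_closedZ linL2).
rewrite -(linear_onZ linL2 si)// -(linear_onB linL2 si)//.
apply: inner_ae => //; last exact: ae_eq_refl.
by apply: filterS LuE => x /(_ Logic.I) e _; rewrite !fctE e !fctE; ring.
Qed.

(** An upper bound for [(g, G a g)] that does not depend on [a]. *)
Let C : R := M * \int[mu]_x g x.

Let inner_g_le a : 0 < a -> inner mu g (G a g) <= C.
Proof.
move=> a0; have /L1P intg := g1.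
rewrite /C -RintegralZl//; apply: ae_le_Rintegral.
- exact: L2_mul_integrable (resolvent_L2 a0).
- exact: (integrableZl measurableT M intg).
move: hM (le_potential a0) g_ge0; apply: filterS3 => x hx Gh g0.
by rewrite mulrC ler_wpM2r// (le_trans Gh)// (le_trans (ler_norm _) hx).
Qed.

(** Combines [E0 <= E] with [E(G_a g, G_a g) = (g, G_a g) - a |G_a g|^2]. The L^2 term is kept to
    show that [a G_a g] vanishes in the limit. *)
Let energy a : 0 < a ->
  E0 (G a g) (G a g) + a * inner mu (G a g) (G a g) <= C.
Proof.
move=> a0; have u2 := resolvent_L2 a0.
have := leE0 (resolvent_bounded a0); rewrite innerNL//.
have := inner_g_le a0; lra.
Qed.

Let energy_le a : 0 < a -> E0 (G a g) (G a g) <= C.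
Proof.
move=> a0; have := energy a0.
have : 0 <= a * inner mu (G a g) (G a g); last lra.
rewrite mulr_ge0 ?(ltW a0)//.
exact: (semi_inner_ge0 (inner_semi mu) (resolvent_L2 a0)).
Qed.

Let integral_cvg phi : L1 mu phi ->
  \int[mu]_x (G a g x * phi x) @[a --> 0^'+] --> \int[mu]_x (h x * phi x).
Proof.
exact: (resolvent_integral_cvg sfmu resG semS extS g1 g2 g_ge0 mh hM intI Ih).
Qed.

Lemma resolvent_form_cvg u : D0 u -> cvg (E0 (G a g) u @[a --> 0^'+]).
Proof.
have [K _ E0K] := formE0.2; move=> D0u.
apply: (form_cvg formD sfmu resolvent_dom energy_le _ E0K D0u).
by move=> phi phi1 _; apply/cvg_ex; eexists; exact: integral_cvg.
Qed.

(* By the energy estimate a |G_a g|^2 stays bounded, so a G_a g -> 0 in L^2. *)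
Let resolvent_vanish u : L2 mu u ->
  a * inner mu (G a g) u @[a --> 0^'+] --> 0.
Proof.
move=> u2; apply/cvgrPdist_lt => e e0.
have nu0 : 0 <= norm2 mu u by exact: norm2_ge0.
have D_gt0 : 0 < C * norm2 mu u ^+ 2 + 1.
  rewrite ltr_wpDl// mulr_ge0 ?sqr_ge0//.
  (* [C] is nonnegative because it dominates the energy of [G 1 g]. *)
  have := energy_le ltr01; apply: le_trans.
  exact: (form_ge0 formD (resolvent_dom ltr01)).
near=> a; have a0 : 0 < a by near: a; exact: nbhs_right_gt.
(* Chosen so that [(a (G_a g, u))^2 <= a (a |G_a g|^2) |u|^2 <= a C |u|^2 < e^2]. *)
have ae : a < e ^+ 2 / (C * norm2 mu u ^+ 2 + 1).
  by near: a; apply: nbhs_right_lt; rewrite divr_gt0// exprn_gt0.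
rewrite sub0r normrN -(@ltr_pXn2r _ 2)// ?nnegrE ?normr_ge0 ?ltW//.
have Ga2 := resolvent_L2 a0.
have nGa : a * norm2 mu (G a g) ^+ 2 <= C.
  rewrite sqr_norm2//; have := energy a0.
  by have := form_ge0 formD (resolvent_dom a0); lra.
move: ae; rewrite ltr_pdivlMr// => ae.
rewrite normrM (gtr0_norm a0) exprMn.
have := inner_norm2 Ga2 u2; rewrite -(@ler_pXn2r _ 2)// ?nnegrE ?mulr_ge0 ?norm2_ge0//.
rewrite exprMn; set x := norm2 mu (G a g) ^+ 2; set y := norm2 mu u ^+ 2.
move=> iGu; have y0 : 0 <= y by rewrite sqr_ge0.
apply: le_lt_trans ae.
apply: (@le_trans _ _ (a ^+ 2 * (x * y))); first by rewrite ler_pM2l ?exprn_gt0.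
have axy : a * x * y <= C * y by rewrite ler_wpM2r.
rewrite expr2 -[leLHS]mulrA ler_pM2l//.
by rewrite mulrA (le_trans axy)// lerDl.
Unshelve. all: by end_near. Qed.

(** Here [nu] stands for [N u]. The form is written as [(g, u) - a (G_a g, u)] minus the integral of
    [G_a g nu], and each term has a known limit. *)
Lemma resolvent_form_lim (u nu : T -> R) : D0 u -> L1 mu nu ->
  (forall a, 0 < a -> inner mu (- L (G a g)) u =
     E0 (G a g) u + \int[mu]_x (G a g x * nu x)) ->
  inner mu u g = lim (E0 (G a g) u @[a --> 0^'+]) + \int[mu]_x (h x * nu x).
Proof.
move=> D0u nu1 decu; have u2 := form_sub formD D0u.
have cvE : E0 (G a g) u @[a --> 0^'+] -->
    inner mu g u - 0 - \int[mu]_x (h x * nu x).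
  apply: (@cvg_trans _ ((fun a => inner mu g u - a * inner mu (G a g) u
      - \int[mu]_x (G a g x * nu x)) @ 0^'+)).
    apply: near_eq_cvg; near=> a.
    have a0 : 0 < a by near: a; exact: nbhs_right_gt.
    by have := decu a a0; rewrite innerNL// => ->; rewrite addrK.
  apply: cvgB; last exact: integral_cvg.
  by apply: cvgB; [exact: cvg_cst|exact: resolvent_vanish].
by rewrite (cvg_lim _ cvE)// innerC subr0 subrK.
Unshelve. all: by end_near. Qed.

(** Minimising energy gives the Cauchy property, and the order constraints give a.e. convergence of
    the whole sequence by squeezing. *)
Lemma potential_extended : exists z : nat -> T -> R,
  [/\ forall n, D0 (z n), cauchy_for (fun v => E0 v v) z &
      \forall x \ae mu, z n x @[n --> \oo] --> h x].
Proof.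
pose c (n : nat) : R := 1 - n.+1%:R^-1.
(* Order intervals shrinking to h play the role of the convex hulls of the tails
   of G_a g. *)
pose K n := [set v | D0 v /\ \forall x \ae mu, c n * I n.+1 x <= v x <= h x].
have linD := form_lin formD.
have I_ge0 : \forall x \ae mu, forall n, 0 <= I n x.
  apply: ae_foralln => n.
  exact: (time_integral_ge0 sfmu semS extS g1 g2 g_ge0 (intI n)).
have ndI : \forall x \ae mu, forall n, I n x <= I n.+1 x.
  apply: ae_foralln => n.
  apply: (le_time_integral sfmu semS extS g1 g2 g_ge0 _ (intI n) (intI n.+1)).
  by rewrite ler_nat.
have c_ge0 n : 0 <= c n by rewrite subr_ge0 invf_le1// ler1n.
have c_le n : c n <= c n.+1.
  by rewrite lerD2l lerN2 lef_pV2 ?posrE// ler_nat.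
have [||||z [zK zc]] := @mazur _ _ _ _ (sym_form_semi formD) K C.
- by move=> n v [].
(* The lower bounds increase with [n], as products of nonnegative nondecreasing factors. *)
- move=> n v [Dv Kv]; split => //; move: Kv I_ge0 ndI.
  apply: filterS3 => x /andP[cv vh] I0 II; rewrite vh andbT.
  apply: le_trans cv; apply: ler_pM => //.
- move=> n u v [Du Ku] [Dv Kv]; split.
    by apply: (lin_closedZ linD); exact: (lin_closedD linD).
  move: Ku Kv; apply: filterS2 => x /andP[u1 u2] /andP[v1 v2].
  by rewrite !fctE -[_ *: _]/(_ * _); apply/andP; split; lra.
(* With [a = 1/(n+1)^2], [e^{-a(n+1)} = e^{-1/(n+1)} >= 1 - 1/(n+1) = c n], so [G a g] lies in
   [K n]. *)
- move=> n; pose a : R := (n.+1%:R * n.+1%:R)^-1.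
  have a0 : 0 < a by rewrite invr_gt0 mulr_gt0.
  exists (G a g); last by rewrite sym_formE; exact: energy_le.
  split; first exact: resolvent_dom.
  have n0 : 0 < n.+1%:R :> R by [].
  have := time_integral_le_resolvent sfmu resG semS extS g1 g2 g_ge0 a0 n0 (intI n.+1).
  move: I_ge0 (le_potential a0); apply: filterS3 => x I0 -> + /[!andbT].
  apply: le_trans; rewrite ler_wpM2r//.
  apply: le_trans (expR_ge1Dx _).
  by rewrite mulNr /a invfM mulfVK// gt_eqF.
exists z; split; first by move=> n; case: (zK n).
  by move=> e /zc[n0 n0P]; exists n0 => m n mn0 nn0; rewrite -sym_formE; exact: n0P.
have Kz : \forall x \ae mu, forall n, c n * I n.+1 x <= z n x <= h x.
  by apply: ae_foralln => n; case: (zK n).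
move: Kz Ih; apply: filterS2 => x Kz cvI.
apply: (@squeeze_cvgr _ _ _ _ (fun n => c n * I n.+1 x) (fun=> h x)).
- by apply: nearW.
- rewrite -[X in _ --> X]mul1r; apply: cvgM; last first.
    by rewrite (cvg_shiftS (fun n => I n x)).
  rewrite -[X in _ --> X]subr0; apply: cvgB; first exact: cvg_cst.
  exact: cvg_harmonic.
- exact: cvg_cst.
Qed.

End Main.

(** * Transfer to the potential with extended real values *)

Theorem theorem7 (R : realType) (E : ptopologicalType)
  (hausE : hausdorff_space E)
  (borelE : borel_generated_by_continuous R E)
  (mu : {sigma_finite_measure set (borel E) -> \bar R})
  (V : set (borel E -> R)) (A : (borel E -> R) -> (borel E -> R) -> R)
  (formA : is_dirichlet_form mu V A)
  (DLam : set (borel E -> R)) (Lam : (borel E -> R) -> borel E -> R)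
  (genLam : generates_restrictable_semigroup mu V A DLam Lam)
  (G G' : R -> (borel E -> R) -> borel E -> R)
  (resG : is_C0_contraction_resolvent mu G)
  (subG : forall a : R, 0 < a -> sub_markovian mu (fun f => a *: G a f))
  (rangeG : forall a : R, 0 < a -> forall f, L2 mu f ->
    closure_dom mu V A DLam Lam (G a f))
  (formG : forall a : R, 0 < a -> forall f v, L2 mu f -> V v ->
    generalized_form mu V A DLam Lam (G a f) v + a * inner mu (G a f) v
    = inner mu f v)
  (adjG : forall a : R, 0 < a -> is_adjoint mu (G a) (G' a))
  (DL : set (borel E -> R)) (L : (borel E -> R) -> borel E -> R)
  (genL : is_resolvent_generator mu G DL L)
  (T T' T1 : R -> (borel E -> R) -> borel E -> R)
  (semT : semigroup_of_resolvent mu G T)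
  (semT' : semigroup_of_resolvent mu G' T')
  (subT' : forall t : R, 0 < t -> sub_markovian mu (T' t))
  (extT : is_L1_extension mu T T1)
  (D0 : set (borel E -> R)) (E0 : (borel E -> R) -> (borel E -> R) -> R)
  (formE0 : is_sectorial_dirichlet_form mu D0 E0)
  (subE0 : bounded_part mu DL `<=` D0)
  (DN : set (borel E -> R)) (N : (borel E -> R) -> borel E -> R)
  (opN : is_operator mu DN N)
  (decomp : forall u v, bounded_part mu DL u -> (DN `&` D0) v ->
    inner mu (- L u) v = E0 u v + \int[mu]_x (u x * N v x))
  (leE0 : forall u, bounded_part mu DL u -> E0 u u <= inner mu (- L u) u)
  (transT : transient mu T1)
  (g : borel E -> R) (Gg : borel E -> \bar R)
  (gL1b : bounded_part mu (L1 mu) g)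
  (g_gt0 : \forall x \ae mu, 0 < g x)
  (potg : is_potential mu T1 g Gg)
  (GgLoo : ('N[mu]_+oo[Gg] < +oo)%E) :
  [/\ extended_dirichlet_space mu D0 E0 Gg,
      (forall u, D0 u -> cvg (E0 (G a g) u @[a --> 0^'+])) &
      forall u, DN u -> D0 u -> L1 mu (N u) ->
        ((inner mu u g)%:E =
         (lim (E0 (G a g) u @[a --> 0^'+]))%:E
         + \int[mu]_x (Gg x * (N u x)%:E))%E].
Proof.
have sfmu := sigma_finiteT mu.
have [g1 goo] := gL1b.
have [_ [Mg gM]] := (LooP mu g).1 goo.
have g2 := ae_bounded_L2 g1 gM.
have g_ge0 : \forall x \ae mu, 0 <= g x by apply: filterS g_gt0 => x /ltW.
have [mGg [I [intI cvI]]] := potg.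
have [M GgM] := Lnormy_ae_bounded GgLoo.
(* The potential is essentially bounded, hence a.e. finite, and [h] is a real-valued version of
   it. *)
pose h := fine \o Gg.
have mh : measurable_fun setT h by apply: measurableT_comp.
have Gg_fin : \forall x \ae mu, Gg x \is a fin_num.
  apply: filterS GgM => x; rewrite -abse_fin_num ge0_fin_numE//.
  by move=> /le_lt_trans; apply; rewrite ltry.
have hE : \forall x \ae mu, (h x)%:E = Gg x.
  by apply: filterS Gg_fin => x; exact: fineK.
have hM : \forall x \ae mu, `|h x| <= M.
  by move: hE GgM; apply: filterS2 => x <-.
have Ih : \forall x \ae mu, I n x @[n --> \oo] --> h x.
  by move: hE cvI; apply: filterS2 => x <- cvx; exact: (fine_cvg cvx).
split.
- have [z [zD zc zh]] := potential_extended sfmu resG genL semT extT formE0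
    subE0 leE0 g1 g2 g_ge0 mh hM intI Ih.
  split=> //; first by apply: filterS Gg_fin => x; rewrite fin_num_abs.
  exists z; split=> //; move: hE zh; apply: filterS2 => x <- zhx.
  by apply: cvg_EFin => //; exact: nearW.
- move=> u D0u; exact: (resolvent_form_cvg sfmu resG genL semT extT formE0
    subE0 leE0 g1 g2 g_ge0 mh hM intI Ih D0u).
- move=> u DNu D0u Nu1.
  rewrite (resolvent_form_lim sfmu resG genL semT extT formE0
    subE0 leE0 g1 g2 g_ge0 mh hM intI Ih D0u Nu1); last first.
    move=> a a0; apply: decomp => //.
    exact: (resolvent_bounded sfmu resG genL semT extT g1 g2 g_ge0 mh hM intI Ih a0).
  rewrite EFinD; congr (_ + _)%E.
  have mN := Lp_measurable Nu1.
  (* Integrability, by domination with [M |N u|], makes the real and the extended integral agree. *)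
  have inthN : mu.-integrable setT (EFin \o (fun x => h x * N u x)).
    apply: (@ae_le_integrable _ _ _ _ _ (fun x => M * `|N u x|)).
    + exact: measurable_funM.
    + have /L1P intN := Nu1; exact: (integrableZl measurableT M (integrable_abse intN)).
    + by apply: filterS hM => x hx; rewrite normrM ler_wpM2r.
  rewrite /Rintegral fineK; last exact: integrable_fin_num.
  apply: ae_eq_integral => //.
  + exact: (measurable_int mu inthN).
  + by apply: emeasurable_funM => //; exact/measurable_EFinP.
  + by apply: filterS hE => x <- _.
Qed.
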